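(* For every integer $r\geq 2$, the Hom complex $\mathrm{Hom}(\overline{C}_{2r},K_{r+1})$ is an orientable cubical surface of genus $$g(r)=f(r,r+1)=r!\,\frac{r^2-r-2}{2}+1$$ with $n(r)=(2+r^2)\cdot(r+1)!$ vertices, $2(n(r)+2g(r)-2)$ edges, and $n(r)+2g(r)-2$ squares.
   Context: $\overline{C}_{2r}$ is the complement of the cycle graph $C_{2r}$ on $2r$ vertices (same vertex set, edges exactly the non-edges of $C_{2r}$), and $K_n$ is the complete graph on $\{1,\dots,n\}$. Hom complex: for finite simple graphs $G,H$, $\mathrm{Hom}(G,H)$ is the subcomplex of the direct product $\prod_{x\in V(G)}\Delta^{V(H)}$ (where $\Delta^{V(H)}$ is the simplex with vertex set $V(H)$, and the cells of the product are products of simplices, with the product topology) whose non-empty cells are the products $\prod_{x\in V(G)}\eta(x)$ indexed by functions $\eta:V(G)\to 2^{V(H)}\setminus\{\emptyset\}$ such that whenever $\{u,v\}\in E(G)$, every $a\in\eta(u)$ and $b\in\eta(v)$ satisfy $\{a,b\}\in E(H)$. The cell $\eta$ is a face of the cell $\eta'$ iff $\eta(x)\subseteq\eta'(x)$ for all $x\in V(G)$. The cell $\eta$ is a product of simplices of dimensions $|\eta(x)|-1$. A cubical surface is a closed $2$-manifold given as a cell complex all of whose $2$-cells are squares (products of two edges). The numbers $f(r,s)$ are defined by the recurrence $f(r,s)=r f(r-1,s-1)+(r-1)f(r,s-1)$ for $s>r\geq 2$, with boundary values $f(r,r)=r!-1$, $f(1,s)=0$ for $s\geq 1$, and $f(r,s)=0$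 for $r>s$; $\mathrm{Hom}(K_r,K_s)$ is homotopy equivalent to a wedge of $f(r,s)$ spheres of dimension $s-r$. *)

(* Defs.v *)
From HB Require Import structures.
From mathcomp Require Import all_boot all_order all_algebra.
From mathcomp Require Import all_classical all_reals all_analysis.

Set Implicit Arguments.
Unset Strict Implicit.
Unset Printing Implicit Defensive.

Import Order.TTheory GRing.Theory Num.Theory.
Import numFieldNormedType.Exports.

Local Open Scope ring_scope.
Local Open Scope classical_set_scope.

(** * Finite simple graphs *)

Record sgraph := SGraph {
  vertex :> finType;
  edge : rel vertex;
  edge_sym : symmetric edge;
  edge_irr : irreflexive edge }.

(* The first conjunct only matters for n = 1. *)
Definition cycle_edge n : rel 'I_n :=
  fun i j => (i != j) && ((j == ordS i) || (i == ordS j)).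

Lemma cycle_edge_sym n : symmetric (@cycle_edge n).
Proof. by move=> i j; rewrite /cycle_edge eq_sym orbC. Qed.

Lemma cycle_edge_irr n : irreflexive (@cycle_edge n).
Proof. by move=> i; rewrite /cycle_edge eqxx. Qed.

Definition cycle_graph n : sgraph :=
  SGraph (@cycle_edge_sym n) (@cycle_edge_irr n).

Definition compl_edge (G : sgraph) : rel G :=
  fun u v => (u != v) && ~~ edge u v.

Lemma compl_edge_sym (G : sgraph) : symmetric (@compl_edge G).
Proof. by move=> u v; rewrite /compl_edge eq_sym edge_sym. Qed.

Lemma compl_edge_irr (G : sgraph) : irreflexive (@compl_edge G).
Proof. by move=> u; rewrite /compl_edge eqxx. Qed.

Definition complement (G : sgraph) : sgraph :=
  SGraph (@compl_edge_sym G) (@compl_edge_irr G).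

Definition complete_edge n : rel 'I_n := fun i j => i != j.

Lemma complete_edge_sym n : symmetric (@complete_edge n).
Proof. by move=> i j; rewrite /complete_edge eq_sym. Qed.

Lemma complete_edge_irr n : irreflexive (@complete_edge n).
Proof. by move=> i; rewrite /complete_edge eqxx. Qed.

Definition complete_graph n : sgraph :=
  SGraph (@complete_edge_sym n) (@complete_edge_irr n).

(** * Subcomplexes of a product of simplices

   The cell [prod_(x : V) Delta^(eta x)] of [prod_(x : V) Delta^W] is encoded
   by [eta : V -> {set W}], and a subcomplex by the set of its nonempty
   cells. *)

Section ProductComplex.
Variables V W : finType.

Implicit Types (eta tau : {ffun V -> {set W}}).
Implicit Types (K : {set {ffun V -> {set W}}}).

Definition dim_cell eta : nat := (\sum_x (#|eta x| - 1))%N.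

Definition cells K (d : nat) : {set {ffun V -> {set W}}} :=
  [set eta in K | dim_cell eta == d]%SET.

(* A product of two edges (and of vertices in the other factors). *)
Definition is_square eta : bool :=
  (#|[set x | #|eta x| == 2%N]%SET| == 2%N) &&
  [forall x, (#|eta x| == 1%N) || (#|eta x| == 2%N)].

(** ** Geometric realization *)

(* The face of the standard simplex on [W] spanned by [A], in barycentric
   coordinates. *)
Definition simplex_face (R : realType) (A : {set W}) : set {ptws W -> R} :=
  [set t | [/\ forall a, 0 <= t a, \sum_a t a = 1
             & forall a, a \notin A -> t a = 0]].

Definition realization_set (R : realType) K : set {ptws V -> {ptws W -> R}} :=
  [set p | exists2 eta, eta \in K & forall x, simplex_face (eta x) (p x)].

(* [set_type] carries the subspace topology. *)
Definition realization (R : realType) K : topologicalType :=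
  set_type (@realization_set R K).

(** ** Cellular chains *)

Definition del_vertex eta (x : V) (a : W) : {ffun V -> {set W}} :=
  [ffun y => if y == x then (eta x :\ a)%SET else eta y].

(* Exponent of the sign of the face [del_vertex eta x a] in the boundary of
   [eta], from d(s1 x ... x sn) = sum_i (-1)^(dim s1 + ... + dim s(i-1))
   s1 x ... x d(si) x ... x sn and the simplicial boundary formula, the
   vertices of [V] and of [W] being ordered by [enum_rank]. *)
Definition face_sign eta (x : V) (a : W) : nat :=
  (\sum_(y | (enum_rank y < enum_rank x)%N) (#|eta y| - 1)
   + #|[set b in eta x | (enum_rank b < enum_rank a)%N]%SET|)%N.

Definition incidence eta tau : rat :=
  \sum_x \sum_(a in eta x | tau == del_vertex eta x a) (-1) ^+ face_sign eta x a.

(* Boundary map from (d+1)-chains to d-chains, chains being row vectors. *)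
Definition cell_boundary K (d : nat) :
    'M[rat]_(#|cells K d.+1|, #|cells K d|) :=
  \matrix_(i, j) incidence (enum_val i) (enum_val j).

(* Dimension of the first rational homology group. *)
Definition betti1 K : nat :=
  (\rank (kermx (cell_boundary K 0)) - \rank (cell_boundary K 1))%N.

(* The 2-cells can be oriented coherently: their signed sum is a cycle. *)
Definition orientable K : Prop :=
  exists2 eps : 'rV[rat]_#|cells K 2|,
    forall i, eps ord0 i = 1 \/ eps ord0 i = -1 &
    eps *m cell_boundary K 1 = 0.

End ProductComplex.

(** * Surfaces *)

Definition homeomorphic (X Y : topologicalType) : Prop :=
  exists f : X -> Y, exists g : Y -> X,
    [/\ continuous f, continuous g, cancel f g & cancel g f].

Definition closed_2manifold (R : realType) (M : topologicalType) : Prop :=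
  [/\ compact [set: M], hausdorff_space M, @second_countable M &
      forall p : M, exists U : set M, exists O : set (R * R),
        [/\ open U, U p, open O &
            homeomorphic (set_type U) (set_type O)]].

Definition cubical_surface (R : realType) (V W : finType)
    (K : {set {ffun V -> {set W}}}) : Prop :=
  [/\ closed_2manifold R (realization R K),
      forall eta, eta \in K -> (dim_cell eta <= 2)%N &
      forall eta, eta \in cells K 2 -> is_square eta].

(* The genus of a connected closed orientable surface is half of its first
   Betti number. *)
Definition orientable_cubical_surface_of_genus (R : realType) (V W : finType)
    (K : {set {ffun V -> {set W}}}) (g : nat) : Prop :=
  [/\ cubical_surface R K, connected [set: realization R K], orientable K &
      betti1 K = (2 * g)%N].

(** * Hom complexes *)

Definition HomComplex (G H : sgraph) : {set {ffun G -> {set H}}} :=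
  [set eta : {ffun G -> {set H}} |
    [forall x, eta x != finset.set0] &&
    [forall u, forall v, edge u v ==>
      [forall a in eta u, forall b in eta v, edge a b]]]%SET.

(* Number of (s-r)-spheres in the wedge homotopy equivalent to Hom(K_r, K_s);
   the value at r = 0 is a convention. *)
Fixpoint sphere_number (r s : nat) : nat :=
  match s with
  | 0 => 0
  | s'.+1 =>
      if (r <= 1)%N || (s'.+1 < r)%N then 0
      else if r == s'.+1 then r`! - 1
      else r * sphere_number r.-1 s' + r.-1 * sphere_number r s'
  end%N.

(* Main.v *)
Require Import Defs.
From HB Require Import structures.
From mathcomp Require Import all_boot all_order all_algebra.
From mathcomp Require Import zify ring.

(** A cell eta is best read by colors: the color a occupies the set column eta a
    of the vertices x with a in eta x.  Then eta is a cell of the complex iff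
    every row eta x is nonempty and every column is a clique of the cycle C_2r,
    that is the empty set, a vertex or an edge.  There are r+1 columns of size
    at most 2 which together have size 2r + dim eta, so
      sum over a of (2 - |column eta a|) + dim eta = 2       (complex_deficit).
    Hence cells have dimension at most 2, in a square every color sits on an
    edge of the cycle, and since the two neighbours of a vertex cannot absorb
    three colors, squares are products of two edges (row_le2).

    A cell grows by adding an incidence (x, a) for which x extends the clique
    column eta a; a clique of size 0, 1, 2 has 2r, 2, 0 extensions.  So an edge
    lies in two squares, and a vertex, which is a coloring f with clique fibers,
    has 2r edges if f misses a color and 4 edges if two colors are used once.
    Double counting reduces all face numbers to the number of colorings of each
    kind, which are 2 (r+1)! (card_missing) and r^2 (r+1)! (card_surjective).

    Manifold.  A point of the realization is a nonnegative matrix with rows of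
    sum 1 and with columns supported on cliques.  Near the vertex f the entries
    p x (f x) are positive and determined by the other ones.  A color used twice
    leaves no freedom, a color used once leaves a line, and a missing color
    leaves the cone over the cycle, which is a plane (cone_plane).  In both kinds
    of vertices this is a chart with values in R^2.

    Homology.  Recoloring one vertex of the cycle at a time joins all colorings
    (valid_connected), and, since the edges at a vertex are joined through
    squares, crossing edges joins all squares (squares_connected).  The first
    gives rank d1 = V - 1, the second, together with a coherent orientation,
    gives rank d2 = F - 1.  So b1 = 2 - (V - E + F), and the face numbers and the
    recurrence for the number of spheres give b1 = 2g.

    Orientation.  The cone over the cycle is an oriented plane, and the complex is
    a fiber of the map from the product of r+1 such planes to R^2r that takes row
    sums; a fiber of a map between oriented spaces is oriented.  Concretely, the
    orientation of a square compares the order of its incidences by rows with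
    their order by columns; it is the parity of the number of inversions, with a
    correction for the colors on the edge that closes the cycle. *)

Set Implicit Arguments.
Unset Strict Implicit.
Unset Printing Implicit Defensive.

(** * Cliques of an even cycle *)

Section Cycle.
Variables (r : nat) (hr : 2 <= r).
Local Notation n := (2 * r).
Implicit Types x y z : 'I_n.

(** Non-adjacency in the complement of the cycle: the pairs of vertices that may
    carry the same color. *)
Definition touch x y := [|| x == y, y == ordS x | x == ordS y].

Lemma complement_cycleE x y : @edge (complement (cycle_graph n)) x y = ~~ touch x y.
Proof.
rewrite /edge /= /compl_edge /edge /= /cycle_edge /touch !negb_or negb_and negbK.
by case: eqVneq => //= _; rewrite negb_or.
Qed.

Lemma val_ordS x : ordS x = ( if x.+1 == n then 0 else x.+1) :> nat.
Proof.
case: x => i i_lt /=; case: eqP => [->|]; first by rewrite modnn.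
by move=> ?; rewrite modn_small //; lia.
Qed.

Lemma val_ord_pred x : ord_pred x = (if x == 0 :> nat then n.-1 else x.-1) :> nat.
Proof.
case: x => i i_lt /=; case: eqP => [->|]; first by rewrite add0n modn_small //; lia.
by move=> ?; rewrite -addnC -subn1 -addnBA ?modnDl ?modn_small; lia.
Qed.

Lemma odd_ordS x : odd (ordS x) = ~~ odd x.
Proof. rewrite val_ordS; case: eqP => //= e; lia. Qed.

Lemma odd_ord_pred x : odd (ord_pred x) = ~~ odd x.
Proof. by rewrite -{2}[x]ord_predK odd_ordS negbK. Qed.

Lemma ordS_neq x : ordS x != x.
Proof. by apply/eqP => e; have := odd_ordS x; rewrite e; case: odd. Qed.

Lemma ordSS_neq x : ordS (ordS x) != x.
Proof.
apply/eqP => e; have := val_ordS (ordS x); rewrite e val_ordS.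
by have := ltn_ord x; do 2! case: eqP; lia.
Qed.

Lemma ordS_neq_pred x : ordS x != ord_pred x.
Proof. by rewrite -(inj_eq (can_inj (@ordSK n))) ord_predK ordSS_neq. Qed.

Lemma touch_refl x : touch x x. Proof. by rewrite /touch eqxx. Qed.
Lemma touch_sym x y : touch x y = touch y x.
Proof. by rewrite /touch eq_sym; case: (y == x) => //=; rewrite orbC. Qed.
Lemma touch_ordS x : touch x (ordS x). Proof. by rewrite /touch eqxx orbT. Qed.

Lemma touchE x y : touch x y = (y \in [:: x; ordS x; ord_pred x]).
Proof.
by rewrite !inE /touch [x == y]eq_sym [x == ordS y]eq_sym (can2_eq (@ordSK n) (@ord_predK n)).
Qed.

(** An even cycle is bipartite, so its cliques have at most one vertex of each
    parity. *)
Lemma touch_parity x y : touch x y -> odd x = odd y -> x = y.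
Proof.
rewrite touchE !inE => /or3P[] /eqP -> //; rewrite ?odd_ordS ?odd_ord_pred; by case: odd.
Qed.

Lemma touch_ordS_pred x : touch (ordS x) (ord_pred x) = false.
Proof.
apply/negP => /touch_parity; rewrite odd_ordS odd_ord_pred => /(_ erefl) /eqP.
by rewrite (negPf (ordS_neq_pred x)).
Qed.

Definition clique (S : {set 'I_n}) := [forall x in S, forall y in S, touch x y].

Lemma cliqueP (S : {set 'I_n}) :
  reflect (forall x y, x \in S -> y \in S -> touch x y) (clique S).
Proof.
apply: (iffP forall_inP) => [h x y xS yS|h x xS]; first by have /forall_inP := h x xS; apply.
by apply/forall_inP => y; exact: h.
Qed.

Lemma clique_sub (S T : {set 'I_n}) : S \subset T -> clique T -> clique S.
Proof. by move=> /subsetP ST /cliqueP cT; apply/cliqueP => x y /ST xT /ST yT; exact: cT. Qed.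

Lemma clique_form (S : {set 'I_n}) : clique S ->
  [\/ S = set0, exists x, S = [set x] | exists x, S = [set x; ordS x]].
Proof.
move=> /cliqueP cS; have [->|[x xS]] := set_0Vmem S; first by constructor 1.
have Sx y : y \in S -> y \in [:: x; ordS x; ord_pred x] by rewrite -touchE; exact: cS.
have [sS|sS] := boolP (ordS x \in S).
  constructor 3; exists x; apply/setP => y; rewrite !inE.
  apply/idP/orP => [yS|[/eqP->|/eqP->] //].
  move: (Sx y yS); rewrite !inE => /or3P[yx|yx|/eqP yp]; [by left|by right|].
  have := cS _ _ sS yS; by rewrite yp touch_ordS_pred.
have [pS|pS] := boolP (ord_pred x \in S).
  constructor 3; exists (ord_pred x); apply/setP => y; rewrite !inE ord_predK.
  apply/idP/orP => [yS|[/eqP->|/eqP->] //].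
  move: (Sx y yS); rewrite !inE => /or3P[yx|yx|yx]; [by right| |by left].
  by rewrite -(eqP yx) yS in sS.
constructor 2; exists x; apply/setP => y; rewrite !inE.
apply/idP/eqP => [yS|-> //].
move: (Sx y yS); rewrite !inE => /or3P[] /eqP yx //; subst y.
  by rewrite yS in sS.
by rewrite yS in pS.
Qed.

Lemma clique_card (S : {set 'I_n}) : clique S -> #|S| <= 2.
Proof.
by case/clique_form => [->|[x ->]|[x ->]]; rewrite ?cards0 ?cards1 ?cards2 //; case: (_ != _).
Qed.

Lemma clique1 x : clique [set x].
Proof. by apply/cliqueP => y z /set1P-> /set1P->; exact: touch_refl. Qed.

Lemma clique2 x : clique [set x; ordS x].
Proof.
apply/cliqueP => y z /set2P[]-> /set2P[]->; rewrite ?touch_refl ?touch_ordS //.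
by rewrite touch_sym touch_ordS.
Qed.

Definition clique_extensions (S : {set 'I_n}) := [set y | (y \notin S) && clique (y |: S)].

Lemma clique_extensions0 : clique_extensions set0 = setT.
Proof. by apply/setP => y; rewrite !inE setU0 clique1. Qed.

Lemma clique_extensions1 x : clique_extensions [set x] = [set ordS x; ord_pred x].
Proof.
apply/setP => y; rewrite !inE; apply/andP/orP.
  case=> yx /cliqueP/(_ x y); rewrite !inE !eqxx orbT => /(_ erefl erefl).
  by rewrite touchE !inE (negPf yx) /= => /orP.
case=> /eqP->; first by rewrite ordS_neq setUC clique2.
split; first by rewrite -{2}[x]ord_predK eq_sym ordS_neq.
by rewrite -{2}[x]ord_predK clique2.
Qed.

Lemma clique_extensions2 x : clique_extensions [set x; ordS x] = set0.
Proof.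
apply/setP => y; rewrite !inE; apply/negP => /andP[yN /clique_card].
by rewrite cardsU1 !inE yN cards2 eq_sym ordS_neq.
Qed.

(** The case of the empty clique is where the two kinds of vertices of the complex
    differ: elsewhere the number of extensions is linear in the defect 2 - |S|. *)
Lemma card_clique_extensions (S : {set 'I_n}) : clique S ->
  #|clique_extensions S| = if #|S| == 0 then n else 2 * (2 - #|S|).
Proof.
case/clique_form => [->|[x ->]|[x ->]].
- by rewrite clique_extensions0 cards0 cardsT card_ord.
- by rewrite clique_extensions1 cards1 cards2 ordS_neq_pred.
- by rewrite clique_extensions2 cards0 cards2 [x == _]eq_sym ordS_neq.
Qed.

End Cycle.

(** * Rows and columns of a cell *)

Section Rows.
Variables V W : finType.
Implicit Types (eta tau : {ffun V -> {set W}}) (x y : V) (a b : W).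

Definition column eta a : {set V} := [set x | a \in eta x].

Definition add_vertex eta x a : {ffun V -> {set W}} :=
  [ffun y => if y == x then a |: eta x else eta y].

Lemma del_addK eta x a : a \notin eta x -> del_vertex (add_vertex eta x a) x a = eta.
Proof.
move=> aN; apply/ffunP => y; rewrite !ffunE eqxx; case: eqP => [->|//].
by rewrite setU1K.
Qed.

Lemma add_delK eta x a : a \in eta x -> add_vertex (del_vertex eta x a) x a = eta.
Proof.
move=> ax; apply/ffunP => y; rewrite !ffunE eqxx; case: eqP => [->|//].
by rewrite setD1K.
Qed.

Lemma mem_add eta x a y b : (b \in add_vertex eta x a y) = ((y == x) && (b == a)) || (b \in eta y).
Proof. by rewrite ffunE; case: eqP => [->|//]; rewrite !inE. Qed.

Lemma mem_del eta x a y b : (b \in del_vertex eta x a y) = ~~ ((y == x) && (b == a)) && (b \in eta y).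
Proof. by rewrite ffunE; case: eqP => [->|//]; rewrite !inE. Qed.

Lemma column_add eta x a b :
  column (add_vertex eta x a) b = if b == a then x |: column eta a else column eta b.
Proof.
apply/setP => y; rewrite inE mem_add; case: (eqVneq b a) => [->|ba]; rewrite !inE ?andbT //.
by rewrite andbF.
Qed.

Lemma card_pairs (A : {set V * W}) : #|A| = \sum_x \sum_a ((x, a) \in A).
Proof.
rewrite pair_bigA /= -sum1_card big_mkcond /=.
by apply: eq_bigr => -[x a] _ /=; case: (_ \in A).
Qed.

Lemma sum_columns eta : \sum_a #|column eta a| = \sum_x #|eta x|.
Proof.
under eq_bigr => a _ do rewrite -sum1dep_card big_mkcond /=.
rewrite exchange_big /=; apply: eq_bigr => x _.
by rewrite -big_mkcond /= sum1_card.
Qed.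

Lemma sum_rows eta : (forall x, eta x != set0) -> \sum_x #|eta x| = #|V| + dim_cell eta.
Proof.
move=> eta0; rewrite -sum1_card -big_split /=; apply: eq_bigr => x _.
by have := eta0 x; rewrite -card_gt0; case: #|_| => // k; rewrite subn1 add1n.
Qed.

Lemma dim_add eta x a : a \notin eta x -> eta x != set0 ->
  dim_cell (add_vertex eta x a) = (dim_cell eta).+1.
Proof.
move=> aN ex; rewrite /dim_cell (bigD1 x) //= [in RHS](bigD1 x) //= ffunE eqxx cardsU1 aN.
rewrite -addSn; congr (_ + _).
  by move: ex; rewrite -card_gt0; case: #|_| => // k; rewrite !subn1.
by apply: eq_bigr => y /negPf yx; rewrite ffunE yx.
Qed.

Definition vertex_cell (f : V -> W) : {ffun V -> {set W}} := [ffun x => [set f x]].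

End Rows.

(** * Cells of the coloring complex *)

(** Locked, as rewriting with membership lemmas would otherwise unfold it. *)
HB.lock Definition coloring_complex r : {set {ffun 'I_(2 * r) -> {set 'I_r.+1}}} :=
  HomComplex (complement (cycle_graph (2 * r))) (complete_graph r.+1).

Section Cells.
Variables (r : nat) (hr : 2 <= r).
Local Notation n := (2 * r).
Local Notation V := 'I_n.
Local Notation W := 'I_r.+1.
Implicit Types (eta tau : {ffun V -> {set W}}) (x y : V) (a b : W).

Local Notation K := (coloring_complex r).

Lemma in_complex eta :
  (eta \in K) = [forall x, eta x != set0] && [forall a, clique (column eta a)].
Proof.
rewrite coloring_complex.unlock inE; congr (_ && _); apply/forallP/forallP => h.
  move=> a; apply/cliqueP => x y; rewrite !inE => ax ay; apply/negPn/negP => xy.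
  move/forallP: (h x) => /(_ y); rewrite complement_cycleE xy /=.
  by move=> /forall_inP/(_ a ax)/forall_inP/(_ a ay); rewrite /edge /= /complete_edge eqxx.
move=> x; apply/forallP => y; apply/implyP; rewrite complement_cycleE => xy.
apply/forall_inP => a ax; apply/forall_inP => b bx; apply/negP => /eqP ab; subst b.
by move/cliqueP: (h a) => /(_ x y); rewrite !inE (negPf xy) => /(_ ax bx).
Qed.

Lemma complex_row eta x : eta \in K -> eta x != set0.
Proof. by rewrite in_complex => /andP[/forallP/(_ x)]. Qed.

Lemma complex_col eta a : eta \in K -> clique (column eta a).
Proof. by rewrite in_complex => /andP[_ /forallP/(_ a)]. Qed.

Lemma complex_touch eta a x y : eta \in K -> a \in eta x -> a \in eta y -> touch x y.
Proof. by move=> /complex_col -/(_ a)/cliqueP h ax ay; apply: h; rewrite inE. Qed.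

Lemma complex_downward eta tau : eta \in K -> (forall x, tau x != set0) ->
  (forall x, tau x \subset eta x) -> tau \in K.
Proof.
move=> etaK t0 te; rewrite in_complex; apply/andP; split; apply/forallP => // a.
apply: clique_sub (complex_col a etaK); apply/subsetP => x; rewrite !inE.
exact: (subsetP (te x)).
Qed.

Lemma card_column_le2 eta a : eta \in K -> #|column eta a| <= 2.
Proof. by move=> /complex_col/clique_card -> . Qed.

Lemma complex_sum eta : eta \in K -> \sum_a #|column eta a| = n + dim_cell eta.
Proof.
by move=> etaK; rewrite sum_columns sum_rows ?card_ord // => x; exact: complex_row.
Qed.

Lemma complex_deficit eta : eta \in K ->
  \sum_a (2 - #|column eta a|) + dim_cell eta = 2.
Proof.
move=> etaK; have := complex_sum etaK.
have : \sum_a (2 - #|column eta a|) + \sum_a #|column eta a| = r.+1 * 2.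
  rewrite -big_split /= (eq_bigr (fun=> 2)) ?sum_nat_const ?card_ord // => a _.
  by rewrite subnK // card_column_le2.
lia.
Qed.

Lemma dim_le2 eta : eta \in K -> dim_cell eta <= 2.
Proof. by move=> /complex_deficit; lia. Qed.

Lemma deficit_le eta a : eta \in K -> 2 - #|column eta a| + dim_cell eta <= 2.
Proof.
by move=> /complex_deficit; rewrite (bigD1 a) //=; lia.
Qed.

Lemma deficit2_le eta a b : eta \in K -> a != b ->
  (2 - #|column eta a|) + (2 - #|column eta b|) + dim_cell eta <= 2.
Proof.
move=> /complex_deficit + ab; rewrite (bigD1 a) //= (bigD1 b) 1?eq_sym //=.
lia.
Qed.

Lemma in_cells eta d : (eta \in cells K d) = (eta \in K) && (dim_cell eta == d).
Proof. by rewrite inE. Qed.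

(** The incidences whose addition (for addable) or removal (for removable) yields a
    cell of dimension one more or one less. *)
Definition addable eta := [set p : V * W | (p.2 \notin eta p.1) && (add_vertex eta p.1 p.2 \in K)].
Definition removable eta := [set p : V * W | (p.2 \in eta p.1) && (1 < #|eta p.1|)].

Lemma mem_addable eta x a : eta \in K -> ((x, a) \in addable eta) = (x \in clique_extensions (column eta a)).
Proof.
move=> etaK; rewrite !inE /= in_complex; congr (_ && _).
have -> : [forall y, add_vertex eta x a y != set0].
  apply/forallP => y; have /set0Pn[b by_] := complex_row y etaK.
  by apply/set0Pn; exists b; rewrite mem_add by_ orbT.
apply/forallP/idP => [/(_ a)|h b]; rewrite column_add ?eqxx //.
by case: eqP => _ //; exact: complex_col.
Qed.

Lemma addable_complex eta x a : (x, a) \in addable eta -> add_vertex eta x a \in K.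
Proof. by rewrite inE => /andP[]. Qed.

Lemma card_addable eta : eta \in K -> #|addable eta| = \sum_a #|clique_extensions (column eta a)|.
Proof.
move=> etaK; rewrite card_pairs exchange_big /=.
apply: eq_bigr => a _; rewrite -sum1_card [RHS]big_mkcond /=.
by apply: eq_bigr => x _; rewrite mem_addable //; case: (_ \in _).
Qed.

Lemma addable_cells eta x a d : eta \in cells K d -> (x, a) \in addable eta ->
  add_vertex eta x a \in cells K d.+1.
Proof.
rewrite !in_cells => /andP[etaK /eqP de]; rewrite inE => /andP[/= aN addK].
by rewrite addK dim_add ?de ?complex_row /=.
Qed.

Lemma removable_complex eta x a : eta \in K -> (x, a) \in removable eta -> del_vertex eta x a \in K.
Proof.
move=> etaK; rewrite inE /= => /andP[ax ex].
apply: (complex_downward etaK) => y; last first.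
  by apply/subsetP => b; rewrite mem_del => /andP[].
rewrite /del_vertex ffunE; have [_|_] := eqVneq y x; last exact: (complex_row _ etaK).
by rewrite -card_gt0; move: ex; rewrite (cardsD1 a) ax add1n ltnS.
Qed.

Lemma addable_removable eta x a : eta \in K -> (x, a) \in addable eta -> (x, a) \in removable (add_vertex eta x a).
Proof.
move=> etaK; rewrite !inE /= => /andP[aN _]; rewrite mem_add !eqxx /=.
rewrite ffunE eqxx cardsU1 aN ltnS card_gt0; exact: (complex_row _ etaK).
Qed.

Lemma removable_addable eta x a : eta \in K -> (x, a) \in removable eta -> (x, a) \in addable (del_vertex eta x a).
Proof.
move=> etaK; rewrite !inE /= => /andP[ax _].
by rewrite mem_del !eqxx add_delK.
Qed.

Lemma removable_cells eta x a d : eta \in cells K d.+1 -> (x, a) \in removable eta ->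
  del_vertex eta x a \in cells K d.
Proof.
rewrite !in_cells => /andP[etaK /eqP de] dn; have dK := removable_complex etaK dn.
rewrite dK /= -eqSS -de eq_sym; apply/eqP.
rewrite -(@dim_add _ _ _ x a) ?add_delK //.
- by move: dn; rewrite inE => /andP[].
- by rewrite mem_del !eqxx.
- exact: complex_row.
Qed.

(** Both sides count the pairs of a d-cell and a (d+1)-cell above it: adding the
    incidence is inverse to removing it. *)
Lemma double_count d :
  \sum_(eta in cells K d) #|addable eta| = \sum_(eta in cells K d.+1) #|removable eta|.
Proof.
pose S1 := [set p : {ffun V -> {set W}} * (V * W) | (p.1 \in cells K d) && (p.2 \in addable p.1)].
pose S2 := [set p : {ffun V -> {set W}} * (V * W) | (p.1 \in cells K d.+1) && (p.2 \in removable p.1)].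
have cardS (A : {set {ffun V -> {set W}}}) (B : _ -> {set V * W}) :
    \sum_(eta in A) #|B eta| = #|[set p : {ffun V -> {set W}} * (V * W) | (p.1 \in A) && (p.2 \in B p.1)]|.
  under eq_bigr => eta _ do rewrite -sum1_card.
  rewrite pair_big_dep /= -sum1_card; apply: eq_bigl => p; by rewrite inE.
rewrite !cardS -/S1 -/S2.
have -> : S2 = [set (add_vertex p.1 p.2.1 p.2.2, p.2) | p in S1].
  apply/setP => -[eta [x a]]; rewrite inE /=; apply/andP/imsetP => [[etaC dn]|[[tau [y b]]]].
    have etaK : eta \in K by move: etaC; rewrite in_cells => /andP[].
    exists (del_vertex eta x a, (x, a)).
      by rewrite inE /= (removable_cells etaC dn) removable_addable.
    rewrite /= add_delK //; by move: dn; rewrite inE => /andP[].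
  rewrite inE /= => /andP[tC tup] [-> -> ->].
  have tK : tau \in K by move: tC; rewrite in_cells => /andP[].
  by split; [exact: addable_cells|exact: addable_removable].
rewrite card_in_imset // => -[tau [x a]] [tau' [x' a']].
rewrite !inE /= => /andP[_ /andP[aN _]] /andP[_ /andP[aN' _]] [e ex ea]; subst x' a'.
by rewrite -(del_addK aN) e del_addK.
Qed.

(** In a square each color at x sits on an edge of the cycle, hence also at a
    neighbour of x. *)
Lemma square_row_touch eta x : eta \in cells K 2 ->
  #|eta x| <= #|eta (ordS x)| + #|eta (ord_pred x)|.
Proof.
rewrite in_cells => /andP[etaK /eqP de].
apply: leq_trans (leq_card_setU _ _).1; apply: subset_leq_card.
apply/subsetP => a ax; rewrite inE.
have := deficit_le a etaK; rewrite de => ca.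
have : 1 < #|column eta a| by lia.
rewrite (cardsD1 x) inE ax ltnS card_gt0 => /set0Pn[y].
rewrite !inE => /andP[yx ay]; have := complex_touch etaK ax ay.
by rewrite touchE !inE (negPf yx) /= => /orP[] /eqP <-; rewrite ay ?orbT.
Qed.

(** A row of size at least 3 would need dimension 2 on its own, leaving one color for each
    neighbour, but by the previous lemma the neighbours carry its three colors. *)
Lemma row_le2 eta x : eta \in K -> #|eta x| <= 2.
Proof.
move=> etaK; have d2 := dim_le2 etaK.
have rx y : 0 < #|eta y| by rewrite card_gt0 complex_row.
have dE : dim_cell eta = (#|eta x| - 1) + \sum_(y | y != x) (#|eta y| - 1).
  by rewrite /dim_cell (bigD1 x).
have [d1|] := leqP (dim_cell eta) 1; first lia.
move=> d1; have de : dim_cell eta = 2 by lia.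
have := @square_row_touch eta x; rewrite in_cells etaK de eqxx => /(_ erefl).
move: dE; rewrite (bigD1 (ordS x)) ?ordS_neq //= (bigD1 (ord_pred x)) /=; last first.
  rewrite [ord_pred x == ordS x]eq_sym ordS_neq_pred // andbT.
  by rewrite -{2}[x]ord_predK eq_sym ordS_neq.
by have := rx x; have := rx (ordS x); have := rx (ord_pred x); lia.
Qed.

Lemma card_removable eta : eta \in K -> #|removable eta| = 2 * dim_cell eta.
Proof.
move=> etaK; rewrite card_pairs /dim_cell big_distrr /=.
apply: eq_bigr => x _.
rewrite (eq_bigr (fun a => if (a \in eta x) then (#|eta x| - 1) else 0)); last first.
  move=> a _; rewrite inE /=; case: (a \in eta x) => //=.
  have := row_le2 x etaK; have := complex_row x etaK; rewrite -card_gt0.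
  by case: #|_| => [|[|[|]]].
rewrite -big_mkcond /= sum_nat_const.
have := row_le2 x etaK; have := complex_row x etaK; rewrite -card_gt0.
by case: #|_| => [|[|[|]]].
Qed.

Lemma complex_square eta : eta \in cells K 2 -> is_square eta.
Proof.
move=> eC; have := eC; rewrite in_cells => /andP[etaK /eqP de].
have row12 x : (#|eta x| == 1) || (#|eta x| == 2).
  have := row_le2 x etaK; have := complex_row x etaK; rewrite -card_gt0.
  by case: #|_| => [|[|[|]]].
apply/andP; split; last exact/forallP.
apply/eqP; apply: etrans de; rewrite -sum1_card big_mkcond /=; apply: eq_bigr => x _.
by rewrite inE; case/orP: (row12 x) => /eqP ->.
Qed.

Lemma card_addable_edge eta : eta \in cells K 1 -> #|addable eta| = 2.
Proof.
rewrite in_cells => /andP[etaK /eqP de]; rewrite card_addable //.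
rewrite (eq_bigr (fun a => 2 * (2 - #|column eta a|))); last first.
  move=> a _; rewrite card_clique_extensions ?complex_col //.
  by have := deficit_le a etaK; rewrite de; case: eqP => // ->.
rewrite -big_distrr /=; have := complex_deficit etaK; rewrite de addn1 => -[->].
by [].
Qed.

Lemma card_addable_vertex eta : eta \in cells K 0 ->
  #|addable eta| = if [exists a, column eta a == set0] then n else 4.
Proof.
rewrite in_cells => /andP[etaK /eqP de]; rewrite card_addable //.
have := complex_deficit etaK; rewrite de addn0 => def.
case: existsP => [[a /eqP ca]|h].
  rewrite (bigD1 a) //= ca clique_extensions0 cardsT card_ord big1 ?addn0 // => b ba.
  rewrite card_clique_extensions ?complex_col //.
  have := deficit2_le etaK ba; rewrite ca cards0 de.
  by case: #|_| => [|[|c]]; rewrite ?subSS ?sub0n ?muln0.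
rewrite (eq_bigr (fun a => 2 * (2 - #|column eta a|))); first by rewrite -big_distrr /= def.
move=> a _; rewrite card_clique_extensions ?complex_col // cards_eq0.
by case: eqP => // ca; case: h; exists a; rewrite ca.
Qed.

Lemma edges_squares : #|cells K 1| = 2 * #|cells K 2|.
Proof.
have := double_count 1.
rewrite (eq_bigr (fun=> 2)) => [|eta]; last exact: card_addable_edge.
rewrite [RHS](eq_bigr (fun=> 4)) => [|eta]; last first.
  by rewrite in_cells => /andP[eK /eqP de]; rewrite card_removable // de.
by rewrite !sum_nat_const; lia.
Qed.

End Cells.

(** * Vertices of the complex: colorings with clique fibers *)

Section Colorings.
Variables (r : nat) (hr : 2 <= r).
Local Notation n := (2 * r).
Local Notation V := 'I_n.
Local Notation W := 'I_r.+1.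
Local Notation K := (coloring_complex r).
Implicit Types (f g : {ffun V -> W}) (x y z u v : V) (a b c : W).

Definition valid f := [forall x, forall y, (f x == f y) ==> touch x y].

Lemma validP f : reflect (forall x y, f x = f y -> touch x y) (valid f).
Proof.
apply: (iffP forallP) => [h x y fxy|h x].
  by move/forallP: (h x) => /(_ y)/implyP; rewrite fxy eqxx; apply.
by apply/forallP => y; apply/implyP => /eqP; exact: h.
Qed.

Lemma column_vertex f a : column (vertex_cell f) a = [set x | f x == a].
Proof. by apply/setP => x; rewrite !inE ffunE inE eq_sym. Qed.

Lemma vertex_cell_valid f : (vertex_cell f \in K) = valid f.
Proof.
rewrite in_complex; apply/andP/validP => [[_ /forallP h] x y fxy|h].
  by move/cliqueP: (h (f x)) => /(_ x y); rewrite column_vertex !inE fxy eqxx; apply.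
split; apply/forallP.
  by move=> x; rewrite ffunE; apply/set0Pn; exists (f x); rewrite set11.
by move=> a; apply/cliqueP => x y; rewrite column_vertex !inE => /eqP fx /eqP fy; apply: h; rewrite fx.
Qed.

Lemma vertex_cell_inj : injective (fun f => vertex_cell f).
Proof.
move=> f g /ffunP e; apply/ffunP => x; have := e x; rewrite !ffunE => /setP/(_ (f x)).
by rewrite !inE eqxx => /esym/eqP.
Qed.

Lemma vertex_cell_dim f : dim_cell (vertex_cell f) = 0.
Proof. by rewrite /dim_cell big1 // => x _; rewrite ffunE cards1. Qed.

Lemma vertex_cells f : (vertex_cell f \in cells K 0) = valid f.
Proof. by rewrite in_cells vertex_cell_dim eqxx andbT vertex_cell_valid. Qed.

Lemma cells0P eta : eta \in cells K 0 -> exists2 f, valid f & eta = vertex_cell f.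
Proof.
rewrite in_cells => /andP[etaK /eqP d0].
have c1 x : #|eta x| == 1.
  move/eqP: d0; rewrite sum_nat_eq0 => /forallP/(_ x)/=.
  by have := complex_row x etaK; rewrite -card_gt0; case: #|_| => [|[|]].
have ex x : exists a, eta x == [set a] by have /cards1P[a ->] := c1 x; exists a.
have E : eta = vertex_cell [ffun x => xchoose (ex x)].
  by apply/ffunP => x; rewrite !ffunE; apply/eqP/(xchooseP (ex x)).
by eexists; last exact: E; rewrite -vertex_cell_valid -E.
Qed.

Lemma card_vertices : #|cells K 0| = #|[set f | valid f]|.
Proof.
rewrite -(card_imset _ vertex_cell_inj); apply: eq_card => eta.
apply/idP/imsetP => [/cells0P[f vf ->]|[f]]; first by exists f; rewrite ?inE.
by rewrite inE => vf ->; rewrite vertex_cells.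
Qed.

Lemma valid_parity f x y : valid f -> f x = f y -> odd x = odd y -> x = y.
Proof. by move=> /validP vf /vf; exact: touch_parity. Qed.

Lemma valid_pair f x y : valid f -> f (ordS x) = f x -> f y = f x -> y = x \/ y = ordS x.
Proof.
move=> /validP vf fs fy; have : touch x y by apply: vf.
rewrite touchE !inE => /or3P[/eqP|/eqP|/eqP yp]; [by left|by right|].
by have : touch (ordS x) y; [apply: vf; rewrite fs fy|rewrite yp touch_ordS_pred].
Qed.

Definition single f x := [forall y, (f y == f x) ==> (y == x)].

Lemma singleP f x : reflect (forall y, f y = f x -> y = x) (single f x).
Proof.
apply: (iffP forallP) => h y; first by move=> e; have := h y; rewrite e eqxx => /eqP.
by apply/implyP => /eqP/h ->.
Qed.

Lemma not_single f x : valid f -> ~~ single f x -> f (ordS x) = f x \/ f (ord_pred x) = f x.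
Proof.
move=> /validP vf; rewrite negb_forall => /existsP[y]; rewrite negb_imply => /andP[/eqP fy yx].
have := vf _ _ (esym fy); rewrite touchE !inE (negPf yx) /=.
by case/orP => /eqP <-; [left|right].
Qed.

Definition missing f := [exists a, [forall x, f x != a]].

Lemma missingP f : reflect (exists a, forall x, f x != a) (missing f).
Proof. by apply: (iffP existsP) => -[a]; [move/forallP|move=> h]; exists a => //; exact/forallP. Qed.

Definition parity_class p : {set V} := [set x : V | odd x == p].

Lemma card_parity p : #|parity_class p| = r.
Proof.
have eq1 : #|parity_class true| = #|parity_class false|.
  rewrite -(card_imset _ (can_inj (@ordSK n))); apply: eq_card => x; rewrite inE.
  apply/imsetP/idP => [[y]|]; first by rewrite inE => /eqP yt ->; rewrite odd_ordS // yt.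
  by move=> xf; exists (ord_pred x); rewrite ?ord_predK // inE odd_ord_pred // (eqP xf).
have := cardsC (parity_class true); rewrite card_ord.
have -> : ~: parity_class true = parity_class false.
  by apply/setP => x; rewrite !inE; case: odd.
by case: p; rewrite eq1; lia.
Qed.

Definition parity_colors f p := f @: parity_class p.

Lemma card_parity_colors f p : valid f -> #|parity_colors f p| = r.
Proof.
move=> vf; rewrite card_in_imset ?card_parity // => x y; rewrite !inE => /eqP xp /eqP yp e.
by apply: valid_parity vf e _; rewrite xp.
Qed.

(** Vertices of the same parity have different colors, so the even vertices use r
    colors and so do the odd ones.  If a color is missing, only r colors remain
    and the two sets of colors coincide. *)
Lemma missing_not_single f x : valid f -> missing f -> ~~ single f x.
Proof.
move=> vf /missingP[a fa].
set E := parity_colors f (odd x); set O := parity_colors f (~~ odd x).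
have leU : #|E :|: O| <= r.
  have : E :|: O \subset [set~ a].
    by apply/subsetP => b; rewrite !inE => /orP[] /imsetP[y _ ->]; exact: fa.
  by move/subset_leq_card; rewrite cardsC1 card_ord.
have : E \subset O.
  have -> : O = E :|: O by apply/eqP; rewrite eqEcard subsetUr card_parity_colors.
  exact: subsetUl.
move/subsetP/(_ (f x)); rewrite imset_f ?inE // => /(_ erefl)/imsetP[y].
rewrite inE => /eqP yp fxy; apply/negP => /singleP/(_ y (esym fxy)) e.
by move: yp; rewrite e; case: odd.
Qed.

(** If all r+1 colors are used, the colors of the two parity classes, r each, have
    union of size r+1, so exactly one color is special to each class. *)
Lemma surjective_single f p : valid f -> ~~ missing f ->
  exists u, [/\ odd u = p, single f u & forall x, odd x = p -> single f x -> x = u].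
Proof.
move=> vf; move=> mf.
set E := parity_colors f p; set O := parity_colors f (~~ p).
have EO : E :|: O = setT.
  apply/setP => a; rewrite [RHS]inE; apply: contraR mf => aN.
  apply/missingP; exists a => x; apply: contraNneq aN => <-; rewrite inE.
  have [xp|xp] := eqVneq (odd x) p; first by rewrite imset_f // inE xp.
  by rewrite [X in _ || X]imset_f ?orbT // inE; move: xp; case: odd; case: (p).
have : #|E :\: O| == 1.
  have : #|E :|: O| = r.+1 by rewrite EO cardsT card_ord.
  have := cardsUI E O; have := cardsID O E.
  by rewrite !card_parity_colors // => h1 h2 h3; apply/eqP; lia.
move=> /cards1P[a Ea].
have : a \in E :\: O by rewrite Ea set11.
rewrite inE => /andP[aO /imsetP[u]]; rewrite inE => /eqP u_par fu.
exists u; split => //.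
  apply/singleP => y fy; apply: (valid_parity vf fy).
  rewrite u_par; apply/eqP; apply: contraNT aO => yp; rewrite fu -fy imset_f // inE.
  by move: yp; case: odd; case: (p).
move=> x xp /singleP sx; apply: (valid_parity vf); last by rewrite xp u_par.
apply: etrans fu; apply/set1P; rewrite -Ea inE; apply/andP; split.
  apply/negP => /imsetP[y]; rewrite inE => /eqP yp fxy.
  by move: yp; rewrite (sx y) // xp; case: (p).
by apply: imset_f; rewrite inE xp.
Qed.

Lemma val_iter_ordS k x : iter k (@ordS n) x = (x + k) %% n :> nat.
Proof.
elim: k => [|k IH] /=; first by rewrite addn0 modn_small.
by rewrite IH -addn1 modnDml addn1 addnS.
Qed.

Lemma odd_iter k x : odd (iter (2 * k) (@ordS n) x) = odd x.
Proof.
elim: k => [|k IH]; first by rewrite muln0.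
by rewrite mulnS !iterS !odd_ordS // negbK.
Qed.

Lemma parity_reach x y : odd x = odd y -> exists k, y = iter (2 * k) (@ordS n) x.
Proof.
move=> xy; have xn := ltn_ord x; have yn := ltn_ord y.
exists ((y + n - x) %/ 2); apply: val_inj; rewrite /= val_iter_ordS.
have -> : 2 * ((y + n - x) %/ 2) = y + n - x by lia.
by rewrite subnKC ?modnDr ?modn_small //; lia.
Qed.

(** The fibers form the perfect matching of the cycle whose edges start at the
    vertices of parity p. *)
Definition paired p f := [forall x : V, (odd x == p) ==> (f (ordS x) == f x)].

Lemma pairedP p f : reflect (forall x, odd x = p -> f (ordS x) = f x) (paired p f).
Proof.
apply: (iffP forallP) => h x; first by move=> xp; have := h x; rewrite xp eqxx => /eqP.
by apply/implyP => /eqP/h ->.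
Qed.

Lemma paired_not_single p f x : paired p f -> ~~ single f x.
Proof.
move=> /pairedP pf; apply/negP => /singleP sx.
have [xp|xp] := eqVneq (odd x) p.
  by have := odd_ordS hr x; rewrite (sx _ (pf x xp)); case: odd.
have := pf (ord_pred x); rewrite odd_ord_pred // ord_predK => e.
have := odd_ord_pred hr x; rewrite (sx (ord_pred x)); first by case: odd.
by rewrite -e //; move: xp; case: odd; case: (p).
Qed.

Lemma paired_missing p f : valid f -> paired p f -> missing f.
Proof.
move=> vf pf; apply: contraT => mf.
by have [u [_ su _]] := surjective_single true vf mf; rewrite (negPf (paired_not_single u pf)) in su.
Qed.

(** Without singletons the fibers are the edges of a perfect matching, and one edge
    of the matching determines it by going round the cycle two steps at a time. *)
Lemma missing_paired f : valid f -> missing f -> paired false f || paired true f.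
Proof.
move=> vf mf; have ns x := missing_not_single x vf mf.
have step x : f (ordS x) = f x -> f (ordS (ordS (ordS x))) = f (ordS (ordS x)).
  move=> fx; have [//|] := not_single vf (ns (ordS (ordS x))).
  rewrite ordSK fx => e; have := valid_parity vf e.
  by rewrite !odd_ordS // negbK => /(_ erefl)/eqP; rewrite eq_sym (negPf (ordSS_neq hr x)).
have all x : f (ordS x) = f x -> paired (odd x) f.
  move=> fx; apply/pairedP => y /esym/parity_reach[k ->].
  by elim: k => [|k IH]; [rewrite muln0|rewrite mulnS !iterS; exact: step].
have x0 : V by apply: (@Ordinal n 0); lia.
suff [x fx] : exists x, f (ordS x) = f x by have := all x fx; case: odd => ->; rewrite ?orbT.
have [e|e] := not_single vf (ns x0); first by exists x0.
by exists (ord_pred x0); rewrite ord_predK.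
Qed.

Lemma paired_excl f : valid f -> paired false f -> paired true f -> False.
Proof.
move=> vf /pairedP p0 /pairedP p1.
have x0 : V by apply: (@Ordinal n 0); lia.
have := valid_parity vf (_ : f (ordS (ordS x0)) = f x0); rewrite !odd_ordS // negbK.
have fS x : f (ordS x) = f x by case E: (odd x); [exact: p1|exact: p0].
rewrite !fS => /(_ erefl erefl)/eqP; by rewrite (negPf (ordSS_neq hr x0)).
Qed.

Definition recolor f x a : {ffun V -> W} := [ffun y => if y == x then a else f y].
(** Giving x the color a keeps all fibers cliques. *)
Definition legal f x a := [forall y, (f y == a) ==> touch x y].

Lemma recolor_id f x : recolor f x (f x) = f.
Proof. by apply/ffunP => y; rewrite ffunE; case: eqP => [->|]. Qed.

Lemma legalP f x a : reflect (forall y, f y = a -> touch x y) (legal f x a).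
Proof.
apply: (iffP forallP) => h y; first by move/eqP; exact: implyP (h y).
by apply/implyP => /eqP/h.
Qed.

Lemma recolor_valid f x a : valid f -> legal f x a -> valid (recolor f x a).
Proof.
move=> /validP vf /legalP lf; apply/validP => y z; rewrite !ffunE.
case: eqVneq => [->|yx]; case: eqVneq => [->|zx] //.
- by rewrite touch_refl.
- by move=> /esym; exact: lf.
- by move=> /lf; rewrite touch_sym.
- exact: vf.
Qed.

End Colorings.

(** * Connectivity of the 1-skeleton *)

Section Connectivity.
Variables (r : nat) (hr : 2 <= r).
Local Notation n := (2 * r).
Local Notation V := 'I_n.
Local Notation W := 'I_r.+1.
Implicit Types (f g : {ffun V -> W}) (x y z u v : V) (a b c : W).

(** Connectivity is stated through invariants: a function on colorings that no legal
    recoloring changes is constant on valid colorings.  This form serves for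
    chains, for connected components and for functions on squares alike. *)
Section Invariant.
Variables (T : Type) (h : {ffun V -> W} -> T).
Hypothesis h_inv : forall f x a, valid f -> legal f x a -> h (recolor f x a) = h f.

(** If no even x works for f itself, f pairs each even vertex with its predecessor,
    hence misses a color, and giving that color to any even vertex does it. *)
Lemma unpaired_reach f : valid f -> exists g x,
  [/\ valid g, h g = h f, ~~ odd x & g (ord_pred x) <> g x].
Proof.
move=> vf.
have [/existsP[x /andP[xe /eqP fx]]|nE] := boolP [exists x : V, ~~ odd x && (f (ord_pred x) != f x)].
  by exists f, x.
have pf : paired true f.
  apply/pairedP => x xo; apply/eqP; apply: contraR nE => e; apply/existsP.
  by exists (ordS x); rewrite ordSK odd_ordS // xo eq_sym.
have /missingP[a fa] := paired_missing hr vf pf.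
have x0 : V by apply: (@Ordinal n 0); lia.
have [x xe] : exists x : V, ~~ odd x.
  by case E: (odd x0); [exists (ordS x0); rewrite odd_ordS // E|exists x0; rewrite E].
have lf : legal f x a by apply/legalP => y /eqP; rewrite (negPf (fa y)).
exists (recolor f x a), x; split => //; first exact: recolor_valid.
  exact: h_inv.
have px : ord_pred x == x = false.
  by apply/eqP => e; have := odd_ord_pred hr x; rewrite e; case: odd.
by rewrite !ffunE eqxx px; apply/eqP.
Qed.

(** Starting at an even vertex that is not paired backwards, give to each odd vertex
    in turn the color of its predecessor y: the fiber of y cannot contain the
    vertex before y, because that vertex is either paired by the previous step or
    excluded by the hypothesis at the start. *)
Lemma sweep k f x : valid f -> ~~ odd x -> f (ord_pred x) <> f x ->
  exists g, [/\ valid g, h g = h f &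
    forall i, i < k.+1 -> let y := iter (2 * i) (@ordS n) x in g (ordS y) = g y].
Proof.
move=> vf xe fx.
(* The fiber of y lies in y, its successor and its predecessor; the last is excluded. *)
have legal_sweep g y : valid g -> g (ord_pred y) <> g y -> legal g (ordS y) (g y).
  move=> vg gy; apply/legalP => z gz; have := (validP _ vg) _ _ (esym gz).
  rewrite touchE !inE => /or3P[] /eqP zy; subst z => //; last exact: touch_refl.
  by rewrite touch_sym touch_ordS.
elim: k => [|k [g [vg hg gp]]].
  exists (recolor f (ordS x) (f x)); have lf := legal_sweep f x vf fx.
  split; [exact: recolor_valid|exact: h_inv|].
  move=> [|//] _ /=; rewrite !ffunE eqxx eq_sym (negPf (ordS_neq hr x)) //.
pose y := iter (2 * k.+1) (@ordS n) x.
have ye : ~~ odd y by rewrite odd_iter.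
have gy : g (ord_pred y) <> g y.
  have -> : ord_pred y = ordS (iter (2 * k) (@ordS n) x) by rewrite /y mulnS /= ordSK.
  rewrite gp // => e; have := valid_parity hr vg e; rewrite /y !odd_iter // => /(_ erefl)/eqP.
  by rewrite mulnS /= eq_sym (negPf (ordSS_neq hr _)).
have lg := legal_sweep g y vg gy.
exists (recolor g (ordS y) (g y)); split.
- exact: recolor_valid.
- by rewrite h_inv.
- move=> i; rewrite ltnS leq_eqVlt => /predU1P[->|ik] z; rewrite !ffunE -/y.
    by rewrite eqxx eq_sym (negPf (ordS_neq hr y)).
  have -> : (z == ordS y) = false.
    by apply/eqP => e; have := odd_ordS hr y; rewrite -e odd_iter // (negPf xe) (negPf ye).
  rewrite (inj_eq (can_inj (@ordSK n))); case: eqP => [->//|_].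
  exact: gp.
Qed.

Lemma paired_reach f : valid f -> exists g, [/\ valid g, h g = h f & paired false g].
Proof.
move=> /unpaired_reach[g [x [vg hg xe gx]]].
have [g' [vg' hg' gp]] := sweep n vg xe gx.
exists g'; split => //; first by rewrite hg'.
apply/pairedP => y ye.
have /(parity_reach hr)[k yk] : odd x = odd y by rewrite ye (negPf xe).
have ke : iter (2 * (k %% n)) (@ordS n) x = y.
  apply: val_inj; rewrite /= yk !val_iter_ordS //.
  by rewrite -modnDmr modnMmr modnDmr.
(* after n steps of the sweep all even vertices have been visited *)
by rewrite -ke; apply: gp; rewrite ltnS ltnW // ltn_mod; lia.
Qed.

Definition recolor_pair f x c := recolor (recolor f x c) (ordS x) c.

Lemma recolor_pairE f x c y :
  recolor_pair f x c y = if (y == x) || (y == ordS x) then c else f y.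
Proof. by rewrite !ffunE orbC; case: (y == ordS x). Qed.

Lemma recolor_pairP f x c : valid f -> paired false f -> ~~ odd x -> (forall y, f y != c) ->
  [/\ valid (recolor_pair f x c), paired false (recolor_pair f x c) & h (recolor_pair f x c) = h f].
Proof.
move=> vf pf xe fc.
have l1 : legal f x c by apply/legalP => y /eqP; rewrite (negPf (fc y)).
have v1 := recolor_valid vf l1.
have l2 : legal (recolor f x c) (ordS x) c.
  apply/legalP => y; rewrite ffunE; case: eqP => [->|_] e.
    by rewrite touch_sym touch_ordS.
  by move: (fc y); rewrite e eqxx.
split; [exact: recolor_valid| |by rewrite !h_inv].
apply/pairedP => y ye; rewrite !recolor_pairE (inj_eq (can_inj (@ordSK n))).
have -> : (y == ordS x) = false.
  by apply/eqP => e; have := odd_ordS hr x; rewrite -e ye (negPf xe).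
have -> : (ordS y == x) = false.
  by apply/eqP => e; have := odd_ordS hr y; rewrite e ye (negPf xe).
by rewrite orbF /=; case: eqP => // _; exact: (pairedP _ _ pf).
Qed.

Definition disagree f g := [set x | f x != g x].

(** Induction on the number of disagreements.  At a pair where f and g differ, f can
    take the color of g if f misses it.  Otherwise another pair of f has this
    color; there f and g disagree too, so moving that pair to the missing color of
    f first creates no new disagreement and frees the color. *)
Lemma paired_connected f g : valid f -> paired false f -> valid g -> paired false g -> h f = h g.
Proof.
have [m] := ubnP #|disagree f g|; elim: m f => // m IH f; rewrite ltnS => Dm vf pf vg pg.
have [->//|fg] := eqVneq f g.
have even_rep (k : {ffun V -> W}) (z : V) : valid k -> paired false k -> exists2 y : V, ~~ odd y & k y = k z.
  move=> vk /pairedP pk; case E: (odd z); last by exists z; rewrite ?E.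
  exists (ord_pred z); first by rewrite odd_ord_pred // E.
  by have := pk (ord_pred z); rewrite odd_ord_pred // E ord_predK => <-.
have [x xe fx] : exists2 x : V, ~~ odd x & f x != g x.
  have [z fz] : exists z, f z != g z.
    by apply/existsP; apply: contraR fg; rewrite negb_exists => /forallP E; apply/eqP/ffunP => z; apply/eqP/negPn/E.
  case E: (odd z); last by exists z; rewrite ?E.
  exists (ord_pred z); first by rewrite odd_ord_pred // E.
  have := (pairedP _ _ pf) (ord_pred z); have := (pairedP _ _ pg) (ord_pred z).
  by rewrite odd_ord_pred // E ord_predK => <- // <-.
(* If k misses the color g x, repainting the pair of x settles it. *)
have paint k : valid k -> paired false k -> k x != g x -> (forall y, k y != g x) ->
    [/\ valid (recolor_pair k x (g x)), paired false (recolor_pair k x (g x)),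
     h (recolor_pair k x (g x)) = h k & #|disagree (recolor_pair k x (g x)) g| < #|disagree k g|].
  move=> vk pk kx kg; have [v' p' h'] := recolor_pairP vk pk xe kg; split => //.
  apply: proper_card; apply/properP; split.
    apply/subsetP => y; rewrite !inE recolor_pairE; case: ifP => // /orP[]/eqP->; rewrite ?eqxx //.
    by rewrite (pairedP _ _ pg) ?eqxx // (negPf xe).
  by exists x; rewrite !inE // recolor_pairE eqxx eqxx.
have [/forallP fgx|] := boolP [forall y, f y != g x].
  have [v' p' <- D'] := paint f vf pf fx fgx.
  by apply: IH => //; exact: leq_trans D' Dm.
rewrite negb_forall => /existsP[y']; rewrite negbK => /eqP fy'.
have [y ye fy] := even_rep f y' vf pf; rewrite {}fy' in fy.
have /missingP[c fc] := paired_missing hr vf pf.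
have [v1 p1 h1] := recolor_pairP vf pf ye fc.
have yx : (x == y) = false by apply/eqP => e; move: fx; rewrite e fy -e eqxx.
have xSy : (x == ordS y) = false.
  by apply/eqP => e; have := odd_ordS hr y; rewrite -e (negPf xe) (negPf ye).
have gy : g y != g x.
  apply/eqP => e; have := valid_parity hr vg e; rewrite (negPf xe) (negPf ye) => /(_ erefl)/eqP.
  by rewrite eq_sym yx.
have D1 : #|disagree (recolor_pair f y c) g| <= #|disagree f g|.
  apply: subset_leq_card; apply/subsetP => z; rewrite !inE recolor_pairE.
  case: ifP => // /orP[]/eqP-> _; first by rewrite fy eq_sym.
  by rewrite (pairedP _ _ pf) ?(pairedP _ _ pg) ?fy 1?eq_sym // (negPf ye).
have k1 : recolor_pair f y c x != g x by rewrite recolor_pairE yx xSy.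
have k2 z : recolor_pair f y c z != g x.
  rewrite recolor_pairE; case: ifP => [_|zy]; first by rewrite -fy eq_sym.
  apply/eqP => e; have := valid_pair hr vf ((pairedP _ _ pf) y (negbTE ye)) (y := z).
  by rewrite e fy => /(_ erefl)[]E; rewrite E eqxx ?orbT in zy.
have [v2 p2 h2 D2] := paint _ v1 p1 k1 k2.
rewrite -h1 -h2; apply: IH => //; apply: leq_trans D2 _; exact: leq_trans D1 Dm.
Qed.

Lemma valid_connected f g : valid f -> valid g -> h f = h g.
Proof.
move=> /paired_reach[f' [vf <- pf]] /paired_reach[g' [vg <- pg]].
exact: paired_connected.
Qed.

End Invariant.

End Connectivity.

(** * Counting cells *)

Section Counting.
Variables (r : nat) (hr : 2 <= r).
Local Notation n := (2 * r).
Local Notation V := 'I_n.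
Local Notation W := 'I_r.+1.
Local Notation K := (coloring_complex r).
Implicit Types (f g : {ffun V -> W}) (x y z u v : V) (a b c : W).

Definition paired_colorings p : {set {ffun V -> W}} := [set f : {ffun V -> W} | valid f && paired p f].
Definition split_colorings u v : {set {ffun V -> W}} := [set f : {ffun V -> W} | [&& valid f, single f u & single f v]].

(** The numbers of colorings of the various kinds are compared by injections only:
    card_split closes a cycle of inequalities. *)
Lemma inj_leq_card (A B : {set {ffun V -> W}}) (F : {ffun V -> W} -> {ffun V -> W}) :
  {in A, forall f, F f \in B} -> {in A &, injective F} -> #|A| <= #|B|.
Proof.
move=> FB Fi; rewrite -(card_in_imset Fi); apply: subset_leq_card.
by apply/subsetP => _ /imsetP[f fA ->]; exact: FB.
Qed.

Lemma half_lt x : x./2 < r.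
Proof. by have := ltn_ord x; lia. Qed.
Lemma double_lt (i : 'I_r) : i.*2 < n.
Proof. by have := ltn_ord i; lia. Qed.

(** Such a coloring is an injective coloring of the r pairs by r+1 colors. *)
Lemma card_paired_false : #|paired_colorings false| = r.+1`!.
Proof.
pose D (k : {ffun 'I_r -> W}) : {ffun V -> W} := [ffun x => k (Ordinal (half_lt x))].
have Dd (k : {ffun 'I_r -> W}) (i : 'I_r) : D k (Ordinal (double_lt i)) = k i.
  by rewrite ffunE; congr (k _); apply: val_inj; rewrite /= doubleK.
have Dinj : injective D.
  by move=> k l e; apply/ffunP => i; rewrite -!Dd e.
have -> : paired_colorings false = D @: [set k : {ffun 'I_r -> W} | injectiveb k].
  apply/setP => f; rewrite inE; apply/andP/imsetP => [[vf pf]|[k]].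
    exists [ffun i => f (Ordinal (double_lt i))].
      rewrite inE; apply/injectiveP => i j; rewrite !ffunE => e.
      have := valid_parity hr vf e; rewrite /= !odd_double => /(_ erefl)/(congr1 val)/= ij.
      by apply: val_inj; exact: double_inj.
    apply/ffunP => x; rewrite !ffunE.
    case E: (odd x); last first.
      by congr (f _); apply: val_inj => /=; rewrite -[LHS]odd_double_half E.
    have := (pairedP _ _ pf) (ord_pred x); rewrite odd_ord_pred // E ord_predK => -> //.
    congr (f _); apply: val_inj => /=; have := val_ord_pred hr x; rewrite /= => ->.
    by move: E; case: eqP; lia.
  rewrite inE => /injectiveP ki ->; split.
    apply/validP => x y; rewrite !ffunE => /ki/(congr1 val)/= xy.
    rewrite /touch -!val_eqE /=.
    have := val_ordS hr x; have := val_ordS hr y; rewrite /= => -> ->.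
    by have := ltn_ord x; have := ltn_ord y; case: ifP; case: ifP; lia.
  apply/pairedP => x xe; rewrite !ffunE; congr (k _); apply: val_inj => /=.
  by have := val_ordS hr x; rewrite /= => ->; case: eqP; lia.
rewrite card_imset // card_inj_ffuns !card_ord.
by have := ffactnSr r.+1 r; rewrite subSnn muln1 ffactnn => <-.
Qed.

Definition rotate f : {ffun V -> W} := [ffun x => f (ordS x)].

Lemma rotate_inj : injective rotate.
Proof.
by move=> f g /ffunP e; apply/ffunP => x; have := e (ord_pred x); rewrite !ffunE ord_predK.
Qed.

Lemma touch_ordSS x y : touch (ordS x) (ordS y) = touch x y.
Proof. by rewrite /touch !(inj_eq (can_inj (@ordSK n))). Qed.

Lemma paired_false_true : #|paired_colorings false| <= #|paired_colorings true|.
Proof.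
apply: (@inj_leq_card _ _ rotate); last by move=> f g _ _; exact: rotate_inj.
move=> f; rewrite !inE => /andP[/validP vf /pairedP pf]; apply/andP; split.
  by apply/validP => x y; rewrite !ffunE => /vf; rewrite touch_ordSS.
by apply/pairedP => x xo; rewrite !ffunE pf // odd_ordS // xo.
Qed.

(** Recolor v by the missing color: then its former partner, the successor of v, is
    the even vertex whose color is used once. *)
Lemma paired_true_split v : odd v ->
  #|paired_colorings true| <= #|split_colorings (ordS v) v|.
Proof.
move=> vo.
(* the color that f misses; the default value is never reached *)
pose c f := odflt ord0 [pick a | [forall x, f x != a]].
have cP f : missing f -> forall x, f x != c f.
  rewrite /c; case: pickP => [a /forallP //|h]; case/missingP => a fa.
  by have /forallP := h a; case.
apply: (@inj_leq_card _ _ (fun f => recolor f v (c f))).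
  move=> f; rewrite !inE => /andP[vf pf].
  have fc := cP f (paired_missing hr vf pf).
  have vS : ordS v != v by rewrite ordS_neq.
  apply/and3P; split.
  - by apply: recolor_valid => //; apply/legalP => y /eqP; rewrite (negPf (fc y)).
  - apply/singleP => y; rewrite !ffunE (negPf vS); case: eqP => [_ e|yv e].
      by move: (fc (ordS v)); rewrite e eqxx.
    move: e; rewrite (pairedP _ _ pf) // => e.
    by case: (valid_pair hr vf ((pairedP _ _ pf) v vo) e).
  - by apply/singleP => y; rewrite !ffunE eqxx; case: eqP => // _ e; move: (fc y); rewrite e eqxx.
move=> f g; rewrite !inE => /andP[vf pf] /andP[vg pg] /ffunP e; apply/ffunP => x.
have [->|xv] := eqVneq x v; last by have := e x; rewrite !ffunE (negPf xv).
rewrite -(pairedP _ _ pf) // -(pairedP _ _ pg) //; have := e (ordS v).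
by rewrite !ffunE (negPf (ordS_neq hr v)).
Qed.

(** The successor of u leaves its partner, the next even vertex, and joins u. *)
Lemma split_step u v : ~~ odd u -> odd v -> ordS u != v ->
  #|split_colorings u v| <= #|split_colorings (ordS (ordS u)) v|.
Proof.
move=> ue vo uv.
(* The only odd vertex whose color is used once is v. *)
have nsu f : valid f -> single f u -> single f v -> f (ordS (ordS u)) = f (ordS u).
  move=> vf su sv.
  have ns : ~~ single f (ordS u).
    apply/negP => su'; apply: (negP (uv)); apply/eqP.
    have [mf|mf] := boolP (missing f).
      by have := missing_not_single hr u vf mf; rewrite su.
    have [w [_ _ wu]] := surjective_single hr true vf mf.
    by rewrite (wu (ordS u)) ?odd_ordS // (wu v).
  have [//|] := not_single vf ns; rewrite ordSK => e.
  by have := singleP _ _ su _ (esym e) => /eqP; rewrite (negPf (ordS_neq hr u)).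
have Su : (u == ordS u) = false by rewrite eq_sym (negPf (ordS_neq hr u)).
have SSu : (ordS (ordS u) == ordS u) = false by rewrite (negPf (ordS_neq hr _)).
apply: (@inj_leq_card _ _ (fun f => recolor f (ordS u) (f u))).
  move=> f; rewrite !inE => /and3P[vf su sv].
  have e := nsu f vf su sv.
  apply/and3P; split.
  - apply: recolor_valid => //; apply/legalP => y /(singleP _ _ su) ->.
    by rewrite touch_sym touch_ordS.
  - apply/singleP => y; rewrite !ffunE SSu; case: eqP => [_|yS] fy.
      have := singleP _ _ su _ (esym fy) => /eqP; by rewrite (negPf (ordSS_neq hr u)).
    have ySS : f y = f (ordS u) by rewrite fy.
    by case: (valid_pair hr vf e ySS).
  - apply/singleP => y; rewrite !ffunE [v == _]eq_sym (negPf uv); case: eqP => [_|yS] fy.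
      by have := singleP _ _ sv _ fy => E; move: vo; rewrite -E (negPf ue).
    exact: (singleP _ _ sv).
move=> f g; rewrite !inE => /and3P[vf suf svf] /and3P[vg sug svg] /ffunP e; apply/ffunP => x.
have [->|xS] := eqVneq x (ordS u); last by have := e x; rewrite !ffunE (negPf xS).
by rewrite -nsu // -[RHS]nsu //; have := e (ordS (ordS u)); rewrite !ffunE SSu.
Qed.

(** When the two singletons are neighbours, v joins u and frees a color.  The
    coloring is recovered, since v had the color that is now missing. *)
Lemma split_paired_false v : odd v ->
  #|split_colorings (ord_pred v) v| <= #|paired_colorings false|.
Proof.
move=> vo; set u := ord_pred v.
have vE : v = ordS u by rewrite /u ord_predK.
have ue : ~~ odd u by rewrite /u odd_ord_pred // vo.
have uv : (u == v) = false by rewrite vE eq_sym (negPf (ordS_neq hr u)).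
have merge f : valid f -> single f u -> single f v ->
    valid (recolor f v (f u)) /\ forall y, recolor f v (f u) y != f v.
  move=> vf su sv; split.
    apply: recolor_valid => //; apply/legalP => y /(singleP _ _ su) ->.
    by rewrite vE touch_sym touch_ordS.
  move=> y; rewrite ffunE; have [_|/eqP yv] := eqVneq y v; apply/eqP => fy.
    by have := singleP _ _ sv _ fy => /eqP; rewrite uv.
  by apply: yv; exact: (singleP _ _ sv).
apply: (@inj_leq_card _ _ (fun f => recolor f v (f u))).
  move=> f; rewrite !inE => /and3P[vf su sv].
  have [vr mr] := merge f vf su sv; rewrite vr /=.
  have mf : missing (recolor f v (f u)) by apply/missingP; exists (f v).
  have /orP[//|/pairedP pt] := missing_paired hr vr mf.
  have := pt (ord_pred u); rewrite odd_ord_pred // (negPf ue) ord_predK => /(_ erefl).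
  have pu_v : (ord_pred u == v) = false.
    by rewrite vE eq_sym (negPf (ordS_neq_pred hr u)).
  rewrite !ffunE uv pu_v => e; have := singleP _ _ su _ (esym e) => E.
  by have := odd_ord_pred hr u; rewrite E; case: odd.
move=> f g; rewrite !inE => /and3P[vf suf svf] /and3P[vg sug svg] /ffunP e; apply/ffunP => x.
have [->|xS] := eqVneq x v; last by have := e x; rewrite !ffunE (negPf xS).
(* The recoloring misses both f v and g v; it uses r colors, so they are equal. *)
have [vr mr] := merge f vf suf svf; have [vr' mr'] := merge g vg sug svg.
have E : recolor f v (f u) = recolor g v (g u) by apply/ffunP => y; exact: e.
apply/eqP; apply/negPn/negP => fg.
have : #|parity_colors (recolor f v (f u)) true| <= #|[set~ f v] :\ g v|.
  apply: subset_leq_card; apply/subsetP => b /imsetP[y _ ->]; rewrite !inE mr andbT.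
  by rewrite E mr'.
rewrite card_parity_colors // => le_r.
have := cardsD1 (g v) [set~ f v]; rewrite cardsC1 card_ord !inE eq_sym fg add1n /= => rE.
by rewrite -ltnS -rE ltnn in le_r.
Qed.

(** With v fixed, the even singleton travels from the successor of v to its
    predecessor in steps of two.  At the start and at the end the colorings are
    compared with the two kinds of paired colorings, which are equinumerous, so
    all inequalities are equalities. *)
Lemma card_split u v : ~~ odd u -> odd v -> #|split_colorings u v| = r.+1`!.
Proof.
move=> ue vo; pose u_ k := iter (2 * k) (@ordS n) (ordS v).
have u_even k : ~~ odd (u_ k) by rewrite odd_iter // odd_ordS // vo.
have u_step k : k.+1 < r -> #|split_colorings (u_ k) v| <= #|split_colorings (u_ k.+1) v|.
  move=> kr; rewrite [u_ k.+1]/u_ mulnS !iterS; apply: split_step => //.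
  apply/eqP => E.
  have : iter (2 * k).+2 (@ordS n) v = v by rewrite iterS iterSr.
  move/(congr1 (@nat_of_ord n)); rewrite val_iter_ordS // => e; have vn := ltn_ord v.
  have := divn_eq (v + (2 * k).+2) n; rewrite e; case: ((v + _) %/ n) => [|[|q]]; lia.
have ge_true k : k < r -> #|paired_colorings true| <= #|split_colorings (u_ k) v|.
  elim: k => [|k IH] kr; first exact: paired_true_split.
  by apply: leq_trans (u_step k kr); apply: IH; exact: ltnW.
have u_last : u_ r.-1 = ord_pred v.
  apply: (can_inj (@ordSK n)); rewrite ord_predK /u_ -iterSr -iterS; apply: ord_inj.
  by rewrite val_iter_ordS // -[RHS](modn_small (ltn_ord v)) -(modnDr v n); congr (_ %% _); lia.
have le_false k : k < r -> #|split_colorings (u_ (r.-1 - k)) v| <= #|paired_colorings false|.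
  elim: k => [|k IH] kr; first by rewrite subn0 u_last split_paired_false.
  apply: leq_trans (IH (ltnW kr)); have -> : r.-1 - k = (r.-1 - k.+1).+1 by lia.
  by apply: u_step; lia.
have [k [kr ->]] : exists k, k < r /\ u = u_ k.
  have /(parity_reach hr)[k uk] : odd (ordS v) = odd u by rewrite odd_ordS // vo (negPf ue).
  exists (k %% r); split; first by rewrite ltn_mod; lia.
  apply: val_inj; rewrite uk /u_ /= !val_iter_ordS //.
  by rewrite muln_modr modnDmr.
apply/eqP; rewrite -card_paired_false eqn_leq; apply/andP; split.
  by have := le_false (r.-1 - k); rewrite subKn; [apply; lia|lia].
by apply: leq_trans paired_false_true _; exact: ge_true.
Qed.

Lemma card_paired p : #|paired_colorings p| = r.+1`!.
Proof.
case: p; last exact: card_paired_false.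
have x0 : V by apply: (@Ordinal n 0); lia.
have [v vo] : exists v : V, odd v.
  by case E: (odd x0); [exists x0|exists (ordS x0); rewrite odd_ordS // E].
apply/eqP; rewrite eqn_leq -{2}card_paired_false paired_false_true andbT.
by rewrite -(@card_split (ordS v) v) ?paired_true_split // odd_ordS // vo.
Qed.

(** There are two perfect matchings. *)
Lemma card_missing : #|[set f : {ffun V -> W} | valid f && missing f]| = 2 * r.+1`!.
Proof.
have -> : [set f : {ffun V -> W} | valid f && missing f] = paired_colorings false :|: paired_colorings true.
  apply/setP => f; rewrite !inE -andb_orr; apply: andb_id2l => vf.
  by apply/idP/idP => [/(missing_paired hr vf)|/orP[]] //; exact: paired_missing.
rewrite cardsU !card_paired disjoint_setI0 ?cards0 ?subn0; first by rewrite mul2n addnn.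
rewrite -setI_eq0; apply/eqP/setP => f; rewrite !inE; apply/negP.
by move=> /andP[/andP[vf p0] /andP[_ p1]]; exact: (paired_excl hr vf p0 p1).
Qed.

(** Sort the colorings by their unique even singleton and unique odd singleton. *)
Lemma card_surjective : #|[set f : {ffun V -> W} | valid f && ~~ missing f]| = r ^ 2 * r.+1`!.
Proof.
have -> : #|[set f : {ffun V -> W} | valid f && ~~ missing f]| =
    \sum_(u in parity_class r false) \sum_(v in parity_class r true) #|split_colorings u v|.
  rewrite pair_big_dep /=.
  under eq_bigr => p _ do rewrite -sum1_card big_mkcond /=.
  rewrite exchange_big /= -sum1_card big_mkcond /=; apply: eq_bigr => f _.
  rewrite inE; case: ifP => [/andP[vf mf]|nf].
    have [u [uo su uu]] := surjective_single hr false vf mf.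
    have [v [vo sv uv]] := surjective_single hr true vf mf.
    rewrite (bigD1 (u, v)) /= ?inE ?uo ?vo //= vf su sv big1 // => -[u' v'] /=.
    rewrite !inE => /andP[/andP[/eqP u'o /eqP v'o] ne]; case: ifP => // /and3P[_ su' sv'].
    by move: ne; rewrite (uu u') // (uv v') // eqxx.
  rewrite big1 // => -[u v] _; rewrite inE /=; case: ifP => // /and3P[vf su sv].
  move: nf; rewrite vf /= => /negbFE mf.
  by have := missing_not_single hr u vf mf; rewrite su.
rewrite (eq_bigr (fun=> r * r.+1`!)); last first.
  move=> u; rewrite inE => /eqP ue; rewrite (eq_bigr (fun=> r.+1`!)).
    by rewrite sum_nat_const card_parity.
  by move=> v; rewrite inE => /eqP vo; rewrite card_split // ue.
by rewrite sum_nat_const card_parity // mulnA.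
Qed.

Lemma card_valid : #|[set f : {ffun V -> W} | valid f]| = (2 + r ^ 2) * r.+1`!.
Proof.
rewrite -(cardsID [set f : {ffun V -> W} | missing f]) mulnDl -card_missing -card_surjective.
by congr (_ + _); apply: eq_card => f; rewrite !inE // andbC.
Qed.

Lemma missing_column f : missing f = [exists a, column (vertex_cell f) a == set0].
Proof.
apply: eq_existsb => a; rewrite column_vertex; apply/forallP/eqP => [h|/setP h x].
  by apply/setP => x; rewrite !inE (negPf (h x)).
by have := h x; rewrite !inE => ->.
Qed.

(** Each edge has two ends, and a vertex has 2r or 4 edges according to its kind. *)
Lemma card_edges : #|cells K 1| = 2 * (r * r.+1 * r.+1`!).
Proof.
have := @double_count r 0.
rewrite [RHS](eq_bigr (fun=> 2)); last first.
  by move=> eta; rewrite in_cells => /andP[etaK /eqP d1]; rewrite card_removable // d1.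
rewrite sum_nat_const => e.
have : \sum_(eta in cells K 0) #|addable eta| =
    \sum_(f in [set f : {ffun V -> W} | valid f]) (if missing f then n else 4).
  have -> : cells K 0 = [set vertex_cell f | f : {ffun V -> W} in [set f : {ffun V -> W} | valid f]].
    apply/setP => eta; apply/idP/imsetP => [/cells0P[f vf ->]|[f]].
      by exists f; rewrite ?inE.
    by rewrite inE => vf ->; rewrite vertex_cells.
  rewrite big_imset /=; last by move=> f g _ _; exact: vertex_cell_inj.
  apply: eq_bigr => f; rewrite inE => vf.
  by rewrite card_addable_vertex ?vertex_cells // missing_column.
rewrite e (bigID (fun f => missing f)) /=.
rewrite (eq_bigr (fun=> n)); last by move=> f /andP[_ ->].
rewrite [X in _ + X](eq_bigr (fun=> 4)); last by move=> f /andP[_ /negPf ->].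
rewrite !sum_nat_const.
have -> : #|[pred i in [set f : {ffun V -> W} | valid f] | missing i]| = 2 * r.+1`!.
  by rewrite -card_missing; apply: eq_card => f; rewrite !inE.
have -> : #|[pred i in [set f : {ffun V -> W} | valid f] | ~~ missing i]| = r ^ 2 * r.+1`!.
  by rewrite -card_surjective; apply: eq_card => f; rewrite !inE.
move=> h; apply/eqP; rewrite -(eqn_pmul2r (isT : 0 < 2)) h; apply/eqP.
rewrite -!mulnn; set k := _`!; nia.
Qed.

Lemma card_squares : #|cells K 2| = r * r.+1 * r.+1`!.
Proof. by have := edges_squares hr; rewrite card_edges; lia. Qed.

End Counting.

(** * Connectivity through the edges *)

Section DualConnectivity.
Variables (r : nat) (hr : 2 <= r).
Local Notation n := (2 * r).
Local Notation V := 'I_n.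
Local Notation W := 'I_r.+1.
Local Notation K := (coloring_complex r).
Implicit Types (f g : {ffun V -> W}) (x y z u v : V) (a b c : W) (p q : V * W).
Implicit Types (eta tau : {ffun V -> {set W}}).

Local Notation "eta +: p" := (add_vertex eta p.1 p.2) (at level 50).

Lemma addable_cells_pair eta p d : eta \in cells K d -> p \in addable eta -> eta +: p \in cells K d.+1.
Proof. by case: p => x a; exact: addable_cells. Qed.

Lemma addable_exists eta : eta \in cells K 1 -> exists p, p \in addable eta.
Proof. by move=> e1; apply/set0Pn; rewrite -card_gt0 card_addable_edge. Qed.

Lemma add_vertexC eta p q : (eta +: p) +: q = (eta +: q) +: p.
Proof.
apply/ffunP => x; apply/setP => a; rewrite !mem_add.
by case: (_ && _); case: (_ && _); rewrite ?orbT.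
Qed.

Lemma addable_sym eta p q : eta \in K -> p \in addable eta -> q \in addable eta -> q \in addable (eta +: p) ->
  p \in addable (eta +: q).
Proof.
case: p => x a; case: q => y b etaK /=.
rewrite [in X in X -> _]inE [in X in _ -> X -> _]inE => /andP[/= ax _] /andP[/= by_ _].
rewrite !inE /= !mem_add => /andP[h1 h2].
rewrite (add_vertexC _ (y, b) (x, a)) h2 andbT negb_or ax andbT.
by move: h1; rewrite negb_or => /andP[+ _]; rewrite eq_sym [b == a]eq_sym.
Qed.

Lemma legal_addable f x a : valid f -> legal f x a -> a != f x -> (x, a) \in addable (vertex_cell f).
Proof.
move=> vf lf fxa; rewrite mem_addable ?vertex_cell_valid // inE column_vertex inE eq_sym fxa /=.
apply/cliqueP => y z; rewrite !inE => /orP[/eqP->|/eqP fy] /orP[/eqP->|/eqP fz].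
- exact: touch_refl.
- exact: (legalP _ _ _ lf).
- by rewrite touch_sym; exact: (legalP _ _ _ lf).
- by apply: (validP _ vf); rewrite fy.
Qed.

(** As for vertices, by invariants: a function that agrees on the two squares of every
    edge is constant on squares. *)
Section Invariant.
Variables (T : Type) (h : {ffun V -> {set W}} -> T).
Hypothesis h_inv : forall eta p q, eta \in cells K 1 -> p \in addable eta -> q \in addable eta ->
  h (eta +: p) = h (eta +: q).

(** For a vertex eta: the squares around the edge that leaves eta along p and those
    around the edge that leaves along p' have the same value. *)
Definition linked eta p p' := forall q q', q \in addable (eta +: p) -> q' \in addable (eta +: p') ->
  h ((eta +: p) +: q) = h ((eta +: p') +: q').

Lemma linked_trans eta p1 p2 p3 : eta \in cells K 0 -> p2 \in addable eta ->
  linked eta p1 p2 -> linked eta p2 p3 -> linked eta p1 p3.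
Proof.
move=> e0 up2 l12 l23 q1 q3 uq1 uq3.
have [q2 uq2] := addable_exists (addable_cells_pair e0 up2).
by rewrite (l12 _ q2) // (l23 _ q3).
Qed.

Lemma linked_square eta p q : eta \in cells K 0 -> p \in addable eta -> q \in addable eta ->
  q \in addable (eta +: p) -> linked eta p q.
Proof.
move=> e0 upp upq uq q1 q2 uq1 uq2.
have etaK : eta \in K by move: e0; rewrite in_cells => /andP[].
rewrite (h_inv (addable_cells_pair e0 upp) uq1 uq) add_vertexC.
exact: (h_inv (addable_cells_pair e0 upq) (addable_sym etaK upp upq uq) uq2).
Qed.

(** Different colors extend independently, so the two edges span a square. *)
Lemma linked_color eta x y a b : eta \in cells K 0 -> a != b ->
  (x, a) \in addable eta -> (y, b) \in addable eta -> linked eta (x, a) (y, b).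
Proof.
move=> e0 ab ux uy; apply: linked_square => //.
have etaK : eta \in K by move: e0; rewrite in_cells => /andP[].
rewrite mem_addable //; last exact: addable_complex ux.
by rewrite column_add [b == a]eq_sym (negPf ab) -mem_addable.
Qed.

(** The link of a vertex is connected.  For edges of one color a used once there is
    an edge of a second color to pass through; if a is missing, the edges of color
    a form a cycle in which consecutive ones span a square. *)
Lemma linked_star eta p q : eta \in cells K 0 -> p \in addable eta -> q \in addable eta -> linked eta p q.
Proof.
case: p => x a; case: q => y b e0 ux uy.
have etaK : eta \in K by move: e0; rewrite in_cells => /andP[].
have d0 : dim_cell eta = 0 by move: e0; rewrite in_cells => /andP[_ /eqP].
have [ab|] := eqVneq a b; last by move=> ab; exact: linked_color.
subst b; case: (clique_form hr (complex_col a etaK)) => [ca|[u ca]|[u ca]]; last first.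
- by move: ux; rewrite mem_addable // ca clique_extensions2 // inE.
- have [b ba cb] : exists2 b, b != a & #|column eta b| < 2.
    have [/existsP[b /andP[ba cb]]|] := boolP [exists b, (b != a) && (#|column eta b| < 2)].
      by exists b.
    rewrite negb_exists => /forallP cb; have := complex_deficit hr etaK.
    rewrite d0 (bigD1 a) //= ca cards1 big1 // => b ba; apply/eqP; rewrite subn_eq0.
    by have := cb b; rewrite ba -leqNgt.
  have : clique_extensions (column eta b) != set0.
    rewrite -card_gt0 card_clique_extensions ?complex_col //; case: eqP => _; [lia|by rewrite muln_gt0 subn_gt0 cb].
  case/set0Pn => w; rewrite -mem_addable // => uw.
  by apply: (linked_trans (p2 := (w, b))) => //; apply: linked_color; rewrite // eq_sym.
have upa w : (w, a) \in addable eta by rewrite mem_addable // ca clique_extensions0 inE.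
have step w : linked eta (w, a) (ordS w, a).
  apply: linked_square => //; rewrite mem_addable //; last exact: addable_complex (upa w).
  by rewrite column_add eqxx ca setU0 clique_extensions1 // !inE eqxx.
suff it k : linked eta (x, a) (iter k (@ordS n) x, a).
  have -> : y = iter (y + n - x) (@ordS n) x; last exact: it.
  apply: ord_inj; rewrite val_iter_ordS // subnKC ?modnDr ?modn_small //.
  by have := ltn_ord x; lia.
elim: k => [|k IH]; last exact: linked_trans IH (step _).
by move=> q q' uq uq'; exact: (h_inv (addable_cells_pair e0 (upa x)) uq uq').
Qed.

Definition contains eta f := [forall x, f x \in eta x].

Lemma containsP eta f : reflect (forall x, f x \in eta x) (contains eta f).
Proof. exact: forallP. Qed.

Lemma contains_facet eta f d : eta \in cells K d.+1 -> contains eta f ->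
  exists2 p, p \in addable (del_vertex eta p.1 p.2) &
    [/\ del_vertex eta p.1 p.2 \in cells K d, contains (del_vertex eta p.1 p.2) f &
      eta = del_vertex eta p.1 p.2 +: p].
Proof.
move=> ed /containsP ef; have := ed; rewrite in_cells => /andP[etaK /eqP de].
have [x ex] : exists x, 1 < #|eta x|.
  have [/existsP //|] := boolP [exists x, 1 < #|eta x|].
  rewrite negb_exists => /forallP ex; suff : dim_cell eta = 0 by rewrite de.
  by rewrite /dim_cell big1 // => x _; apply/eqP; rewrite subn_eq0 leqNgt ex.
have : 0 < #|eta x :\ f x| by move: ex; rewrite (cardsD1 (f x)) ef add1n ltnS.
rewrite card_gt0 => /set0Pn[a]; rewrite !inE => /andP[af ax].
have dn : (x, a) \in removable eta by rewrite inE /= ax.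
exists (x, a); first exact: removable_addable.
split; [exact: removable_cells| |by rewrite /= add_delK].
apply/containsP => y; rewrite mem_del ef andbT negb_and.
by case: eqP => //= ->; rewrite eq_sym.
Qed.

Lemma contains_vertex eta f : eta \in cells K 0 -> contains eta f -> eta = vertex_cell f.
Proof.
move=> /cells0P[g vg ->] /containsP fg; apply/ffunP => x; have := fg x.
by rewrite !ffunE inE => /eqP ->.
Qed.

Lemma star_const f eta eta' : eta \in cells K 2 -> eta' \in cells K 2 ->
  contains eta f -> contains eta' f -> h eta = h eta'.
Proof.
move=> e2 e2' ef ef'.
have [p upp [e1 ef1 ->]] := contains_facet e2 ef.
have [p' upp' [e1' ef1' ->]] := contains_facet e2' ef'.
set t := del_vertex eta _ _ in e1 ef1 upp *; set t' := del_vertex eta' _ _ in e1' ef1' upp' *.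
have [q uq [e0 ef0 tE]] := contains_facet e1 ef1.
have [q' uq' [e0' ef0' tE']] := contains_facet e1' ef1'.
have v0 := contains_vertex e0 ef0; have v0' := contains_vertex e0' ef0'.
rewrite v0 in uq tE e0; rewrite v0' in uq' tE'.
clearbody t t'; subst t t'; exact: (linked_star e0 uq uq' upp upp').
Qed.

(** By star_const the value of h on the squares around a vertex depends only on the
    vertex; it does not change along an edge, because an edge lies in a square. *)
Lemma squares_connected eta eta' : eta \in cells K 2 -> eta' \in cells K 2 -> h eta = h eta'.
Proof.
move=> e2 e2'.
pose hv f := omap h [pick s in cells K 2 | contains s f].
have hvE s f : s \in cells K 2 -> contains s f -> hv f = Some (h s).
  move=> s2 sf; rewrite /hv; case: pickP => [t /andP[t2 tf]|/(_ s)]; last by rewrite s2 sf.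
  by congr Some; exact: star_const tf sf.
have ex s : s \in cells K 2 -> exists2 f, valid f & contains s f.
  move=> s2; have sK : s \in K by move: s2; rewrite in_cells => /andP[].
  have ex x : exists a, a \in s x by apply/set0Pn; exact: complex_row.
  have cf : contains s [ffun x => xchoose (ex x)].
    by apply/containsP => x; rewrite ffunE; exact: (xchooseP (ex x)).
  exists [ffun x => xchoose (ex x)] => //; rewrite -vertex_cell_valid.
  apply: (complex_downward sK) => x; rewrite ffunE; first by apply/set0Pn; eexists; exact: set11.
  by rewrite sub1set (containsP _ _ cf).
have [f vf sf] := ex _ e2; have [f' vf' sf'] := ex _ e2'.
suff : Some (h eta) = Some (h eta') by case.
rewrite -(hvE _ f) // -(hvE _ f') //.
apply: (valid_connected hr) => // {vf sf}f x a vf lf.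
have [->|fxa] := eqVneq a (f x).
  by rewrite recolor_id.
have ua := legal_addable vf lf fxa.
have e1 : vertex_cell f +: (x, a) \in cells K 1 by apply: addable_cells ua; rewrite vertex_cells.
have [q uq] := addable_exists e1.
have s2 := addable_cells_pair e1 uq.
rewrite (hvE _ _ s2); last first.
  apply/containsP => y; rewrite !mem_add /= !ffunE inE.
  by case: (y == x); rewrite eqxx ?orbT.
rewrite (hvE _ _ s2) //; apply/containsP => y; rewrite !mem_add /= ffunE.
by rewrite inE eqxx !orbT.
Qed.

End Invariant.

End DualConnectivity.

Import GRing.Theory Num.Theory.
Local Open Scope ring_scope.

(** * Boundary sums and parity of incidences *)

Lemma rank_left_kernel_line (F : fieldType) m k (M : 'M[F]_(m, k)) (v : 'rV_m) :
  v != 0 -> v *m M = 0 -> (forall w : 'rV_m, w *m M = 0 -> (w <= v)%MS) ->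
  \rank M = m.-1.
Proof.
move=> v0 vM h.
have kv : (kermx M :=: v)%MS.
  apply/eqmxP/andP; split; last exact/sub_kermxP.
  apply/row_subP => i; apply: h; rewrite -row_mul mulmx_ker; exact: row0.
have := mxrank_ker M; rewrite kv rank_rV v0 => e.
by have := rank_leq_row M; lia.
Qed.

Section ChainSums.
Variables V W : finType.
Variable K : {set {ffun V -> {set W}}}.
Implicit Types (eta tau : {ffun V -> {set W}}) (p : V * W).

Definition facet_sign eta p : rat := (-1) ^+ face_sign eta p.1 p.2.

Lemma incidenceE eta tau :
  incidence eta tau = \sum_(p | (p.2 \in eta p.1) && (tau == del_vertex eta p.1 p.2)) facet_sign eta p.
Proof. by rewrite /incidence pair_big_dep. Qed.

End ChainSums.

Section Homology.
Variables (r : nat) (hr : (2 <= r)%N).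
Local Notation n := (2 * r)%N.
Local Notation V := 'I_n.
Local Notation W := 'I_r.+1.
Local Notation K := (coloring_complex r).
Implicit Types (f g : {ffun V -> W}) (x y z u v : V) (a b c : W) (p q : V * W).
Implicit Types (eta tau : {ffun V -> {set W}}).

Local Notation "eta +: p" := (add_vertex eta p.1 p.2) (at level 50).

(** The column of the boundary matrix at tau, summed over the incidences of V * W
    instead of the cells above tau. *)
Lemma coboundary_sum d (Y : {ffun V -> {set W}} -> rat) tau : tau \in cells K d ->
  \sum_(eta in cells K d.+1) Y eta * incidence eta tau =
  \sum_(p in addable tau) Y (tau +: p) * facet_sign (tau +: p) p.
Proof.
move=> td; have tK : tau \in K by move: td; rewrite in_cells => /andP[].
under eq_bigr => eta _ do rewrite incidenceE mulr_sumr.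
rewrite (exchange_big_dep predT) //= [RHS]big_mkcond /=.
apply: eq_bigr => -[x a] _ /=; case: ifP => [upx|upx].
  rewrite (big_pred1 (tau +: (x, a))) // => eta /=.
  apply/andP/eqP => [[ed /andP[ax /eqP ->]]|->]; first by rewrite add_delK.
  rewrite (addable_cells td upx) mem_add !eqxx /= del_addK ?eqxx //.
  by move: upx; rewrite inE => /andP[].
rewrite big1 // => eta /andP[ed /andP[ax /eqP te]].
move: upx; rewrite inE /= te add_delK // mem_del ax !eqxx /=.
by move: ed; rewrite in_cells => /andP[->].
Qed.

Lemma boundary_sum d (C : {ffun V -> {set W}} -> rat) eta : eta \in cells K d.+1 ->
  \sum_(tau in cells K d) incidence eta tau * C tau =
  \sum_(p in removable eta) facet_sign eta p * C (del_vertex eta p.1 p.2).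
Proof.
move=> ed; have eK : eta \in K by move: ed; rewrite in_cells => /andP[].
under eq_bigr => tau _ do rewrite incidenceE mulr_suml.
rewrite (exchange_big_dep predT) //= [RHS]big_mkcond /=.
apply: eq_bigr => -[x a] _ /=; case: ifP => [dx|dx].
  rewrite (big_pred1 (del_vertex eta x a)) // => tau /=.
  have := dx; rewrite inE /= => /andP[ax _]; rewrite ax /=.
  by apply/andP/eqP => [[_ /eqP]|->] //; rewrite eqxx (removable_cells ed dx).
rewrite big1 // => tau /andP[td /andP[ax /eqP te]].
have tK : tau \in K by move: td; rewrite in_cells => /andP[].
move: dx; rewrite inE /= ax /= => /negbT; rewrite -leqNgt => ex.
have := complex_row x tK; rewrite te /del_vertex ffunE eqxx -card_gt0.
by move: ex; rewrite (cardsD1 a) ax add1n ltnS leqn0 => /eqP ->.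
Qed.

Lemma sum_delta (T : finType) (t0 : T) (F : T -> nat) :
  (\sum_t (t == t0) * F t = F t0)%N.
Proof.
by rewrite (bigD1 t0) //= eqxx mul1n big1 ?addn0 // => t /negPf ->; rewrite mul0n.
Qed.

Local Open Scope nat_scope.

(** The pairs of incidences of eta in opposite orders by rows and by colors. *)
Definition inversions eta := \sum_p \sum_q
  (p.2 \in eta p.1) * (q.2 \in eta q.1) * ((p.1 < q.1) && (q.2 < p.2)).

Lemma inversions_add eta p : p.2 \notin eta p.1 ->
  inversions (eta +: p) = inversions eta + \sum_q (q.2 \in eta q.1) *
    (((p.1 < q.1) && (q.2 < p.2)) + ((q.1 < p.1) && (p.2 < q.2))).
Proof.
move=> pN; pose I q : nat := q.2 \in eta q.1.
pose w p q : nat := (p.1 < q.1) && (q.2 < p.2).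
transitivity (\sum_t \sum_q (I t * I q * w t q + (t == p) * (I q * w t q)
   + (q == p) * (I t * w t q) + (t == p) * ((q == p) * w t q))).
  apply: eq_bigr => t _; apply: eq_bigr => q _; rewrite -/(w t q).
  have mE s : (s.2 \in (eta +: p) s.1) = I s + (s == p) :> nat.
    rewrite mem_add /I -[(s.1 == p.1) && _]/(s == p).
    by case: eqP => [->|_]; [rewrite (negPf pN)|rewrite addn0].
  by rewrite !mE; ring.
under eq_bigr => t _ do rewrite !big_split /= -[X in _ + X + _ + _]big_distrr /= sum_delta
  -[X in _ + X]big_distrr /= sum_delta.
rewrite !big_split /= !sum_delta {4}/w ltnn /= addn0 -addnA; congr (_ + _).
rewrite -big_split /=; apply: eq_bigr => q _; by rewrite mulnDr.
Qed.

Lemma sum_lt x : \sum_(y < n | y < x) 1 = x.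
Proof.
rewrite -(big_ord_widen n (fun=> 1)) ?sum1_card ?card_ord //; exact: ltnW.
Qed.

(** The sign of a facet counts the incidences that precede p in row order, up to the
    vertices that precede it, since dim = size - 1 in each row. *)
Lemma face_sign_add eta p : eta \in K -> p.2 \notin eta p.1 ->
  face_sign (eta +: p) p.1 p.2 + p.1 = \sum_q (q.2 \in eta q.1) *
    ((q.1 < p.1) + ((q.1 == p.1) && (q.2 < p.2))).
Proof.
case: p => x a /= eK aN.
rewrite -(pair_bigA _ (fun y b => (b \in eta y) * ((y < x) + ((y == x) && (b < a))))) /=.
have rank_val m (i : 'I_m) : enum_rank i = i :> nat by rewrite enum_rank_ord.
have -> : face_sign (add_vertex eta x a) x a =
    \sum_(y < n | y < x) (#|eta y| - 1) + #|[set b in eta x | b < a]|.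
  rewrite /face_sign; congr (_ + _).
    apply: eq_big => y; rewrite !rank_val // => yx.
    by rewrite /add_vertex ffunE -val_eqE /= ltn_eqF.
  apply: eq_card => b; rewrite !inE mem_add eqxx /= !rank_val.
  by case: eqP => [->|_] //; rewrite ltnn !andbF.
rewrite addnAC -[X in _ + X + _](sum_lt x) -big_split /=.
transitivity (\sum_(y : V) ((y < x) * #|eta y| + (y == x) * #|[set b in eta x | b < a]|)).
  have /= D := sum_delta x (fun=> #|[set b in eta x | b < a]|).
  rewrite [RHS]big_split /= D; congr (_ + _).
  rewrite big_mkcond /=; apply: eq_bigr => y _; case: (y < x) => //.
  by rewrite mul1n subnK // card_gt0 complex_row.
apply: eq_bigr => y _.
under [RHS]eq_bigr => b _ do rewrite mulnDr.
rewrite big_split /=; congr (_ + _).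
  by rewrite -big_distrl /= mulnC -sum1_card big_mkcond /=; congr (_ * _); apply: eq_bigr => b _; case: (_ \in _).
case: eqVneq => [->|_] /=; last by rewrite big1 // => b _; rewrite muln0.
by rewrite mul1n -sum1_card big_mkcond /=; apply: eq_bigr => b _; rewrite inE; case: (_ \in _); case: (_ < _).
Qed.

(** Adding p creates the inversions counted in inversions_add.  Together with the
    incidences before p in row order they count, modulo 2, the incidences before p
    in column order, where the other columns drop out because they have even
    size. *)
Lemma parity_add eta p : eta \in K -> p.2 \notin eta p.1 ->
  (forall b, b != p.2 -> ~~ odd #|column eta b|) ->
  odd (inversions (eta +: p) + face_sign (eta +: p) p.1 p.2) =
  odd (inversions eta) (+) odd p.1 (+) odd #|[set y in column eta p.2 | y < p.1]|.
Proof.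
case: p => x a eK aN ev.
have e := face_sign_add eK aN; have e' := inversions_add aN.
set N := inversions _ in e' *; set FS := face_sign _ _ _ in e *.
pose I (q : V * W) : nat := q.2 \in eta q.1.
(* For each incidence q, the inversion with p and the precedence over p add up to: color
   below that of p, plus same color and earlier row, plus an even number. *)
have main : N + FS + x = inversions eta + (\sum_q I q * (q.2 < a)
    + \sum_q I q * ((q.1 < x) && (q.2 == a))
    + (\sum_q I q * ((q.1 < x) && (a < q.2))).*2).
  rewrite -addnA e e' -addnA; congr (_ + _).
  rewrite -mul2n -big_split /= big_distrr /= -!big_split /=; apply: eq_bigr => -[y b] _ /=.
  rewrite -!val_eqE /I /=; case: (b \in eta y); rewrite ?mul0n ?muln0 // !mul1n.
  by case: (ltngtP y x); case: (ltngtP b a).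
have E1 : ~~ odd (\sum_q I q * (q.2 < a)).
  rewrite -(pair_bigA _ (fun y b => (b \in eta y) * (b < a))) /= exchange_big /=.
  apply: (big_ind (fun m => ~~ odd m)) => // [m1 m2|b _]; first by rewrite oddD => /negPf -> /negPf ->.
  rewrite -big_distrl /= oddM negb_and; case: (ltnP b a) => ba; last by rewrite orbT.
  rewrite (_ : \sum_y _ = #|column eta b|) ?ev //.
    by rewrite -val_eqE /= ltn_eqF.
  by rewrite -sum1_card [RHS]big_mkcond /=; apply: eq_bigr => y _; rewrite inE; case: (_ \in _).
have E2 : \sum_q I q * ((q.1 < x) && (q.2 == a)) = #|[set y in column eta a | y < x]|.
  rewrite -(pair_bigA _ (fun y b => (b \in eta y) * ((y < x) && (b == a)))) /=.
  rewrite -sum1_card [RHS]big_mkcond /=; apply: eq_bigr => y _; rewrite !inE.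
  transitivity (nat_of_bool ((a \in eta y) && (y < x))); last by case: (_ && _).
  rewrite -(sum_delta a (fun b => nat_of_bool ((b \in eta y) && (y < x)))).
  by apply: eq_bigr => b _; case: (b == a); case: (_ \in _); case: (y < x).
clear e e'; move: N FS main => N FS /(congr1 odd); rewrite !oddD odd_double /= E2 (negPf E1) addbF /= => main.
have -> : odd N (+) odd FS = odd N (+) odd FS (+) odd x (+) odd x by rewrite addbK.
by rewrite main addbAC.
Qed.

End Homology.

(** * Orientation *)

Section Orientation.
Variables (r : nat) (hr : (2 <= r)%N).
Local Notation n := (2 * r)%N.
Local Notation V := 'I_n.
Local Notation W := 'I_r.+1.
Local Notation K := (coloring_complex r).
Implicit Types (f g : {ffun V -> W}) (x y z u v : V) (a b c : W) (p q : V * W).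
Implicit Types (eta tau : {ffun V -> {set W}}).

Local Notation "eta +: p" := (add_vertex eta p.1 p.2) (at level 50).

Lemma cycle_length_gt0 : (0 < n)%N. Proof. by lia. Qed.
Definition first_vertex : V := Ordinal cycle_length_gt0.
Local Notation v0 := first_vertex.
Local Notation v1 := (ord_pred v0).

(** The number of colors on the edge that closes the cycle: the only edge whose
    orientation from smaller to larger vertex is opposite to that of the cycle. *)
Definition wrapping eta := #|eta v0 :&: eta v1|.

Lemma first_vertex_pred_neq : v1 != v0.
Proof. by rewrite -{2}[v0]ord_predK eq_sym ordS_neq. Qed.

Lemma wrapping_add eta p : p.2 \notin eta p.1 ->
  wrapping (eta +: p) = (wrapping eta +
    (((p.1 == v0) && (p.2 \in eta v1)) || ((p.1 == v1) && (p.2 \in eta v0))))%N.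
Proof.
case: p => x a /= aN; rewrite /wrapping /add_vertex !ffunE ![_ == x]eq_sym.
have card_add (A B : {set W}) : a \notin A -> #|(a |: A) :&: B| = (#|A :&: B| + (a \in B))%N.
  move=> aA; rewrite setIUl; have [aB|aB] := boolP (a \in B).
    by rewrite (setIidPl _) ?sub1set // cardsU1 inE (negPf aA) addnC.
  rewrite (_ : [set a] :&: B = set0) ?set0U ?addn0 //; apply/eqP; rewrite setI_eq0.
  by rewrite disjoints1.
have [xe|x0] := eqVneq x v0.
  by subst x; rewrite [v0 == v1]eq_sym (negPf first_vertex_pred_neq) /= orbF card_add.
have [xe|x1] /= := eqVneq x v1; last by rewrite addn0.
by subst x; rewrite setIC card_add // setIC.
Qed.

Definition orientation_sign eta : rat := (-1) ^+ (inversions eta + wrapping eta).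

(** In dimension 1 the defects sum to 1, so a single color is used once. *)
Lemma edge_form eta : eta \in cells K 1 -> exists a u,
  [/\ column eta a = [set u], forall b, b != a -> #|column eta b| = 2%N &
     addable eta = [set (ordS u, a); (ord_pred u, a)]].
Proof.
rewrite in_cells => /andP[etaK /eqP d1].
have [a ca] : exists a, (#|column eta a| < 2)%N.
  have [/existsP //|] := boolP [exists a, #|column eta a| < 2]%N.
  rewrite negb_exists => /forallP h; have := complex_deficit hr etaK.
  by rewrite d1 big1 // => a _; apply/eqP; rewrite subn_eq0 leqNgt h.
have ca1 : #|column eta a| = 1%N.
  by have := deficit_le hr a etaK; rewrite d1; move: ca; case: #|_| => [|[|]].
have cb b : b != a -> #|column eta b| = 2%N.
  move=> ba; have := deficit2_le hr etaK ba; rewrite d1 ca1.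
  by have := card_column_le2 hr b etaK; case: #|_| => [|[|[|]]].
have [u ua] : exists u, column eta a = [set u] by apply/cards1P; rewrite ca1.
exists a, u; split => //.
apply/setP => -[x b]; rewrite mem_addable //; have [->|ba] := eqVneq b a.
  by rewrite ua clique_extensions1 // !inE !xpair_eqE eqxx !andbT.
have -> : clique_extensions (column eta b) = set0.
  by apply: cards0_eq; rewrite card_clique_extensions ?complex_col // cb.
by rewrite !inE !xpair_eqE (negPf ba) !andbF.
Qed.

Definition oriented_incidence eta p : rat := orientation_sign (eta +: p) * facet_sign (eta +: p) p.

(** An edge extends by the successor or by the predecessor of the vertex u of its
    color used once.  Both have the same parity, and all other columns have size 2,
    so by parity_add the signs differ by the comparison of u with the added vertex
    and by the correction at the closing edge, which together always disagree. *)
Lemma oriented_incidence_opposite eta : eta \in cells K 1 -> exists p q,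
  [/\ p != q, addable eta = [set p; q] & oriented_incidence eta p = - oriented_incidence eta q].
Proof.
move=> e1; have [a [u [ua cb upE]]] := edge_form e1.
have etaK : eta \in K by move: e1; rewrite in_cells => /andP[].
exists (ordS u, a), (ord_pred u, a); split => //.
  by rewrite xpair_eqE eqxx andbT ordS_neq_pred.
have mem_a y : (a \in eta y) = (y == u) by have /setP/(_ y) := ua; rewrite !inE.
have E x : (x, a) \in addable eta -> oriented_incidence eta (x, a) = (-1) ^+
   (odd (inversions eta) (+) odd (wrapping eta) (+) odd x (+)
    ((u < x)%N (+) (((x == v0) && (v1 == u)) || ((x == v1) && (v0 == u))))).
  rewrite inE /= => /andP[aN _]; rewrite /oriented_incidence /orientation_sign /facet_sign /= -exprD.
  rewrite addnAC -[LHS]signr_odd oddD (@parity_add _ _ (x, a)) //=; last first.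
    by move=> b /cb ->.
  rewrite (@wrapping_add _ (x, a)) //= !mem_a oddD oddb; congr (_ ^+ (nat_of_bool _)).
  have -> : #|[set y in column eta a | (y < x)%N]| = (u < x)%N.
    rewrite ua; case: ltnP => ux.
      by apply/eqP/cards1P; exists u; apply/setP => y; rewrite !inE; case: eqP => // ->; rewrite ux.
    by apply: eq_card0 => y; rewrite !inE; case: eqP => // ->; rewrite ltnNge ux.
  rewrite oddb; case: (odd (inversions _)); case: (odd (wrapping _)); case: (odd x);
  by case: (u < x)%N; case: (_ || _).
rewrite !E ?upE ?inE ?eqxx ?orbT //.
have -> : odd (ordS u) = odd (ord_pred u) by rewrite odd_ordS // odd_ord_pred.
have S0 : (ordS u == v0) = (v1 == u).
  by rewrite (can2_eq (@ordSK n) (@ord_predK n)) eq_sym.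
have P1 : (ord_pred u == v1) = (v0 == u).
  by rewrite (inj_eq (can_inj (@ord_predK n))) eq_sym.
have S1 : (ordS u == v1) && (v0 == u) = false.
  by apply/negP => /andP[/eqP + /eqP e]; rewrite -e => /eqP; rewrite (negPf (ordS_neq_pred hr _)).
have P0 : (ord_pred u == v0) && (v1 == u) = false.
  apply/negP => /andP[/eqP + /eqP e]; rewrite -e => /(congr1 (@ordS n)).
  by rewrite ord_predK => /eqP; rewrite eq_sym (negPf (ordS_neq_pred hr _)).
have lS : (u < ordS u)%N = (v1 != u).
  rewrite val_ordS // -(inj_eq (@ord_inj n)) val_ord_pred //=; have := ltn_ord u.
  by case: eqP; lia.
have lP : (u < ord_pred u)%N = (v0 == u).
  by rewrite val_ord_pred // -(inj_eq (@ord_inj n)) /=; have := ltn_ord u; case: eqP; lia.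
rewrite S0 P1 S1 P0 lS lP !andbb /= !orbF; case: (v1 == u); case: (v0 == u); rewrite /= ?addbF ?addbT;
  by case: (_ (+) _); rewrite /= ?expr0 ?expr1 ?opprK.
Qed.

End Orientation.

(** * Rational homology *)

Section Chains.
Variables (V W : finType) (K : {set {ffun V -> {set W}}}).
Implicit Types (eta tau : {ffun V -> {set W}}) (F : {ffun V -> {set W}} -> rat).

Definition chain d F : 'rV[rat]_#|cells K d| := \row_i F (enum_val i).

Lemma chainP d (w : 'rV[rat]_#|cells K d|) : exists F, w = chain d F.
Proof.
have [e0|/set0Pn[t0 t0C]] := eqVneq (cells K d) set0.
  exists (fun=> 0); apply/rowP => i; have := enum_valP i; by rewrite {2}e0 inE.
exists (fun t => w ord0 (enum_rank_in t0C t)); apply/rowP => i.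
by rewrite mxE enum_valK_in.
Qed.

Lemma chain_boundary d F (j : 'I_#|cells K d|) :
  (chain d.+1 F *m cell_boundary K d) ord0 j =
  \sum_(eta in cells K d.+1) F eta * incidence eta (enum_val j).
Proof.
by rewrite mxE [RHS]big_enum_val /=; apply: eq_bigr => i _; rewrite !mxE.
Qed.

Lemma chain_coboundary d F (i : 'I_#|cells K d.+1|) :
  (chain d F *m (cell_boundary K d)^T) ord0 i =
  \sum_(tau in cells K d) incidence (enum_val i) tau * F tau.
Proof.
by rewrite mxE [RHS]big_enum_val /=; apply: eq_bigr => j _; rewrite !mxE mulrC.
Qed.

Lemma chain_neq0 d F eta : eta \in cells K d -> F eta != 0 -> chain d F != 0.
Proof.
move=> ed; apply: contraNneq => /rowP/(_ (enum_rank_in ed eta)).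
by rewrite !mxE enum_rankK_in // => ->.
Qed.

End Chains.

Lemma sphere_number_rec m s : sphere_number m s.+1 =
  (if (m <= 1) || (s.+1 < m) then 0
   else if m == s.+1 then m`! - 1
   else m * sphere_number m.-1 s + m.-1 * sphere_number m s)%N.
Proof. by []. Qed.

Lemma sphere_number_diag m : (1 < m)%N -> sphere_number m m = (m`! - 1)%N.
Proof. by case: m => // m m1; rewrite sphere_number_rec leqNgt m1 ltnn eqxx. Qed.

(** The formula for the genus, doubled and without subtraction. *)
Lemma sphere_number_formula m : (1 < m)%N ->
  (2 * sphere_number m m.+1 + m`! * (m + 2) = m`! * m ^ 2 + 2)%N.
Proof.
elim: m => // m IH; rewrite ltnS leq_eqVlt => /predU1P[<-//|m1].
have -> : sphere_number m.+1 m.+2 = (m.+1 * sphere_number m m.+1 + m * (m.+1`! - 1))%N.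
  rewrite sphere_number_rec leqNgt ltnS (ltnW m1) ltnNge leqnSn ltn_eqF //.
  by rewrite sphere_number_diag // ltnW.
have := congr1 (muln m.+1) (IH m1); rewrite factS; have := fact_gt0 m.
set s := sphere_number _ _; set q := m`!; move=> q0.
have : (m.+1 * q - 1 + 1 = m.+1 * q)%N by rewrite subnK // muln_gt0.
set t := (m.+1 * q - 1)%N; clearbody s q t; rewrite -!mulnn; nia.
Qed.

Section Betti.
Variables (r : nat) (hr : (2 <= r)%N).
Local Notation n := (2 * r)%N.
Local Notation V := 'I_n.
Local Notation W := 'I_r.+1.
Local Notation K := (coloring_complex r).
Implicit Types (f g : {ffun V -> W}) (x y z u v : V) (a b c : W) (p q : V * W).
Implicit Types (eta tau : {ffun V -> {set W}}).

Local Notation "eta +: p" := (add_vertex eta p.1 p.2) (at level 50).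

(** The oriented incidences of an edge are opposite signs, so a chain is a cycle iff
    its product with the orientation is constant across edges. *)
Lemma coboundary_edge F eta : eta \in cells K 1 -> exists p q,
  addable eta = [set p; q] /\
  \sum_(s in cells K 2) F s * incidence s eta =
    (F (eta +: p) * orientation_sign hr (eta +: p) - F (eta +: q) * orientation_sign hr (eta +: q)) * oriented_incidence hr eta p.
Proof.
move=> e1; have [p [q [pq upE eE]]] := oriented_incidence_opposite hr e1.
exists p, q; split => //.
rewrite coboundary_sum // upE big_setU1 ?inE //= big_set1 mulrBl.
rewrite {2}eE mulrN opprK /oriented_incidence.
have e2 s : orientation_sign hr s * orientation_sign hr s = 1 by rewrite -expr2 sqrr_sign.
by rewrite !mulrA -[F (eta +: p) * _ * _]mulrA -[F (eta +: q) * _ * _]mulrA !e2 !mulr1.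
Qed.

Lemma coloring_orientable : orientable K.
Proof.
exists (chain K 2 (orientation_sign hr)).
  by move=> i; rewrite mxE /orientation_sign -signr_odd; case: odd; [right|left].
apply/rowP => j; rewrite chain_boundary mxE.
have [p [q [_ ->]]] := coboundary_edge (orientation_sign hr) (enum_valP j).
by rewrite -!expr2 !sqrr_sign subrr mul0r.
Qed.

Lemma squares_exist : exists eta, eta \in cells K 2.
Proof.
by apply/set0Pn; rewrite -card_gt0 card_squares // !muln_gt0 fact_gt0 /=; lia.
Qed.

Lemma rank_boundary1 : \rank (cell_boundary K 1) = #|cells K 2|.-1.
Proof.
have [s0 s02] := squares_exist.
apply: (rank_left_kernel_line (v := chain K 2 (orientation_sign hr))).
- by apply: (chain_neq0 s02); rewrite /orientation_sign signr_eq0.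
- apply/rowP => j; rewrite chain_boundary mxE.
  have [p [q [_ ->]]] := coboundary_edge (orientation_sign hr) (enum_valP j).
  by rewrite -!expr2 !sqrr_sign subrr mul0r.
move=> w; have [F ->] := chainP w => /rowP w0.
have Fc s : s \in cells K 2 -> F s * orientation_sign hr s = F s0 * orientation_sign hr s0.
  move=> s2; apply: (squares_connected hr (h := fun s => F s * orientation_sign hr s)) s2 s02.
  move=> eta p q e1 upp upq.
  have [p' [q' [upE bE]]] := coboundary_edge F e1.
  have := w0 (enum_rank_in e1 eta); rewrite chain_boundary mxE enum_rankK_in // bE.
  move/eqP; rewrite mulf_eq0 /oriented_incidence /facet_sign /orientation_sign -exprD signr_eq0 orbF subr_eq0 => /eqP e.
  by rewrite upE in upp upq; case/set2P: upp => ->; case/set2P: upq => ->; rewrite ?e.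
have -> : chain K 2 F = (F s0 * orientation_sign hr s0) *: chain K 2 (orientation_sign hr).
  apply/rowP => i; rewrite !mxE -(Fc _ (enum_valP i)) -mulrA -expr2 sqrr_sign mulr1 //.
exact: scalemx_sub.
Qed.

(** The two ends of an edge occur with opposite signs: removing one of two colors
    from the row of x has sign given by whether it is the smaller one. *)
Lemma edge_vertices f x a : valid f -> (x, a) \in addable (vertex_cell f) ->
  forall F, \sum_(t in cells K 0) incidence (vertex_cell f +: (x, a)) t * F t =
  facet_sign (vertex_cell f +: (x, a)) (x, a) * (F (vertex_cell f) - F (vertex_cell (recolor f x a))).
Proof.
move=> vf ua F; set eta := _ +: _.
have e1 : eta \in cells K 1 by apply: addable_cells ua; rewrite vertex_cells.
have fxa : a != f x by move: ua; rewrite inE /= ffunE inE => /andP[].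
have etaE y : eta y = if y == x then [set a; f x] else [set f y].
  by rewrite /eta /add_vertex !ffunE; case: eqP => // ->.
have dE : removable eta = [set (x, a); (x, f x)].
  apply/setP => -[y b]; rewrite !inE !xpair_eqE /= etaE.
  have [_|_] /= := eqVneq y x; first by rewrite !inE cards2 fxa andbT.
  by rewrite cards1 andbF.
rewrite boundary_sum // dE big_setU1 ?inE ?xpair_eqE ?eqxx //= big_set1 /=.
have -> : del_vertex eta x a = vertex_cell f.
  by rewrite /eta del_addK //= ffunE inE.
have -> : del_vertex eta x (f x) = vertex_cell (recolor f x a).
  apply/ffunP => y; apply/setP => b; rewrite mem_del etaE !ffunE.
  have [_|_] /= := eqVneq y x; rewrite !inE //.
  case: (eqVneq b a) => [->|_] /=; first by rewrite fxa.
  by case: (b == f x).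
have fs c : face_sign eta x c = #|[set b in [set a; f x] | (b < c)%N]|.
  rewrite /face_sign big1 ?add0n => [|y]; last first.
    by rewrite !enum_rank_ord /= => yx; rewrite etaE -val_eqE /= ltn_eqF // cards1.
  by rewrite etaE eqxx; apply: eq_card => b; rewrite !inE !enum_rank_ord.
have -> : facet_sign eta (x, f x) = - facet_sign eta (x, a).
  rewrite /facet_sign /= !fs.
  have card1 (c d : W) : #|[set b in [set c; d] | (b < c)%N]| = (d < c)%N.
    case: ltnP => dc.
      apply/eqP/cards1P; exists d; apply/setP => b; rewrite !inE.
      by case: (eqVneq b d) => [->|_]; [rewrite dc orbT|case: eqVneq => [->|//]; rewrite ltnn].
    apply: eq_card0 => b; rewrite !inE.
    by case: (eqVneq b d) => [->|_]; [rewrite ltnNge dc andbF|case: eqVneq => [->|//]; rewrite ltnn].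
  rewrite card1 setUC card1; case: ltngtP => [_|_|/ord_inj e].
  - by rewrite /= expr0 expr1.
  - by rewrite /= expr0 expr1 opprK.
  - by rewrite e eqxx in fxa.
by rewrite mulrBr mulNr.
Qed.

Lemma edge_form_vertex eta : eta \in cells K 1 -> exists f x a,
  [/\ valid f, (x, a) \in addable (vertex_cell f) & eta = vertex_cell f +: (x, a)].
Proof.
move=> e1; have eK : eta \in K by move: e1; rewrite in_cells => /andP[].
have ex x : exists a, a \in eta x by apply/set0Pn; exact: complex_row.
pose f : {ffun V -> W} := [ffun x => xchoose (ex x)].
have ef : contains eta f by apply/containsP => x; rewrite ffunE; exact: (xchooseP (ex x)).
have [[x a] ua [e0 ef0 E]] := contains_facet e1 ef.
have v := contains_vertex e0 ef0.
exists f, x, a; rewrite -vertex_cells -v; split => //.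
Qed.

Lemma rank_boundary0 : \rank (cell_boundary K 0) = #|cells K 0|.-1.
Proof.
rewrite -mxrank_tr.
have [e [eV]] : exists e, e \in cells K 0 /\ true.
  have : (0 < #|cells K 0|)%N by rewrite card_vertices card_valid // muln_gt0 fact_gt0; lia.
  by rewrite card_gt0 => /set0Pn[e eV]; exists e.
move=> _; apply: (rank_left_kernel_line (v := chain K 0 (fun=> 1))).
- by apply: (chain_neq0 eV); rewrite oner_eq0.
- apply/rowP => i; rewrite chain_coboundary mxE.
  have [f [x [a [vf ua ->]]]] := edge_form_vertex (enum_valP i).
  by rewrite edge_vertices // subrr mulr0.
move=> w; have [F ->] := chainP w => /rowP w0.
have Fc f g : valid f -> valid g -> F (vertex_cell f) = F (vertex_cell g).
  apply: (valid_connected hr (h := fun f => F (vertex_cell f))) => {}f x a vf lf.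
  have [->|fxa] := eqVneq a (f x).
    by rewrite recolor_id.
  have ua := legal_addable vf lf fxa.
  have e1 : vertex_cell f +: (x, a) \in cells K 1 by apply: addable_cells ua; rewrite vertex_cells.
  have := w0 (enum_rank_in e1 (vertex_cell f +: (x, a))).
  rewrite chain_coboundary mxE enum_rankK_in // edge_vertices // => /eqP.
  by rewrite mulf_eq0 /facet_sign signr_eq0 /= subr_eq0 => /eqP.
have [f0 vf0 eE] := cells0P eV.
have -> : chain K 0 F = F e *: chain K 0 (fun=> 1).
  apply/rowP => i; rewrite !mxE mulr1; have [f vf ->] := cells0P (enum_valP i).
  by rewrite eE; exact: Fc.
exact: scalemx_sub.
Qed.

(** V - E + F = 2 - 2g. *)
Lemma euler_characteristic : (#|cells K 1| + 2 = 2 * sphere_number r r.+1 + #|cells K 0| + #|cells K 2|)%N.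
Proof.
rewrite card_edges // card_squares // card_vertices card_valid // factS.
have := sphere_number_formula hr; rewrite -!mulnn.
move: hr; set s := sphere_number _ _; set m := _`!; nia.
Qed.

Lemma coloring_betti1 : betti1 K = (2 * sphere_number r r.+1)%N.
Proof.
rewrite /betti1 mxrank_ker rank_boundary0 rank_boundary1.
have := euler_characteristic; have [s s2] := squares_exist.
have : (0 < #|cells K 2|)%N by rewrite card_gt0; apply/set0Pn; exists s.
have : (0 < #|cells K 0|)%N by rewrite card_vertices card_valid // muln_gt0 fact_gt0; lia.
by lia.
Qed.

End Betti.

(** * Subspaces of a finite power of the line *)

From mathcomp Require Import all_classical all_reals all_analysis.
From mathcomp Require Import lra.

Import Order.TTheory numFieldNormedType.Exports.
Local Open Scope classical_set_scope.

Lemma cvg_initial (S : choiceType) (T : topologicalType) (f : S -> T)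
    (F : set_system S) (s : S) :
  Filter F -> f @ F --> f s -> F --> (s : initial_topology f).
Proof.
move=> FF fs A [_ [[C oC <-] Cs] CA].
by apply: filterS CA _; apply: fs; exact: open_nbhs_nbhs.
Qed.

Lemma cvg_ptws (I : eqType) (T : topologicalType) (F : set_system {ptws I -> T})
    (f : {ptws I -> T}) :
  Filter F -> (forall i, (fun g : I -> T => g i) @ F --> f i) -> F --> f.
Proof. by move=> FF fi; apply/cvg_sup => i; apply: cvg_initial. Qed.

Lemma continuous_set_type (X Y : topologicalType) (B : set Y) (g : X -> set_type B) :
  continuous (fun x => \val (g x)) -> continuous g.
Proof. by move=> cg x; apply: cvg_initial; exact: cg. Qed.

Section SubspaceOfProduct.
Variables (R : realType) (V W : finType) (A : set {ptws V -> {ptws W -> R}}).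

(** Convergence in a subspace of the product is convergence of all coordinates; the
    topological properties below are derived from this alone. *)
Lemma cvg_coord (F : set_system (set_type A)) (p : set_type A) :
  Filter F ->
  (forall x a, (fun q : set_type A => (\val q x a : R)) @ F --> (\val p x a : R)) ->
  F --> p.
Proof.
move=> FF Fp; apply: cvg_initial.
by apply: cvg_ptws => x; apply: cvg_ptws => a; exact: Fp.
Qed.

Lemma continuous_coord x a : continuous (fun q : set_type A => (\val q x a : R)).
Proof.
move=> p.
have cp : \val @ p --> \val p by exact: initial_continuous.
have cx : proj x @ \val p --> (\val p x : {ptws W -> R}).
  exact: (@proj_continuous V (fun=> {ptws W -> R}) x).
have ca : proj a @ (\val p x : {ptws W -> R}) --> \val p x a.
  exact: (@proj_continuous W (fun=> R) a).
apply: (@cvg_comp _ _ _ (fun q : set_type A => \val q x) (proj a) (nbhs p)) ca.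
exact: (@cvg_comp _ _ _ \val (proj x) (nbhs p)) cp cx.
Qed.

Lemma continuous_coordP (X : topologicalType) (g : X -> set_type A) :
  (forall x a, continuous (fun z => (\val (g z) x a : R))) -> continuous g.
Proof. by move=> cg z; apply: cvg_coord => x a; exact: cg. Qed.

Lemma coord_inj (p q : set_type A) :
  (forall x a, (\val p x a : R) = \val q x a) -> p = q.
Proof. by move=> pq; apply: val_inj; apply/funext => x; apply/funext => a. Qed.

Lemma hausdorff_coord : hausdorff_space (set_type A).
Proof.
move=> p q pq; apply: coord_inj => x a.
apply: (@Rhausdorff R) => U1 U2 U1p U2q.
have U1p' := continuous_coord U1p; have U2q' := continuous_coord U2q.
by have [t [? ?]] := pq _ _ U1p' U2q'; exists (\val t x a).
Qed.

(** An ultrafilter converges in each coordinate, as [0, 1] is compact; the second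
    hypothesis says that the limit lies in A. *)
Lemma compact_coord :
  (forall q : set_type A, forall x a, 0 <= (\val q x a : R) <= 1) ->
  (forall (F : set_system (set_type A)) (l : V -> W -> R), ProperFilter F ->
    (forall x a, (fun q : set_type A => (\val q x a : R)) @ F --> l x a) -> A l) ->
  compact [set: set_type A].
Proof.
move=> A01 Alim; rewrite compact_ultra => F FU _.
have lim x a : exists l : R, (fun q : set_type A => (\val q x a : R)) @ F --> l.
  have FI : F ((fun q : set_type A => (\val q x a : R)) @^-1` `[0, 1]).
    by apply: filterE => q /=; rewrite in_itv /= A01.
  have [l [_ lF]] := @segment_compact R 0 1 _ (fmap_proper_filter _ _) FI.
  exists l => U Ul.
  have [//|FnU] := in_ultra_setVsetC ((fun q : set_type A => (\val q x a : R)) @^-1` U) FU.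
  by have [t [nt t']] := lF (~` U) U FnU Ul.
pose l x a := xget 0 [set l : R | (fun q : set_type A => (\val q x a : R)) @ F --> l].
have Fl x a : (fun q : set_type A => (\val q x a : R)) @ F --> l x a.
  by have /(xgetPex 0) := lim x a.
have Al : A l by apply: Alim Fl.
exists (exist _ (l : {ptws V -> {ptws W -> R}}) (mem_set Al)); split => //.
by apply: cvg_coord => x a; exact: Fl.
Qed.

Lemma nbhs_coord (p : set_type A) (N : set (set_type A)) : nbhs p N ->
  exists2 e : R, 0 < e &
    forall q : set_type A,
      (forall x a, `|(\val p x a : R) - (\val q x a : R)| < e) -> N q.
Proof.
pose B (e : R) := [set q : set_type A |
  forall x a, `|(\val p x a : R) - (\val q x a : R)| < e].
pose G := filter_from [set e : R | 0 < e] B.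
have FG : Filter G.
  apply: filter_from_filter; first by exists 1; exact: ltr01.
  move=> d e d0 e0; exists (Num.min d e); first by rewrite /= lt_min d0 e0.
  move=> q /= Bq; split=> x a; have := Bq x a; rewrite lt_min; by case/andP.
have Gp : G --> p.
  apply: cvg_coord => x a; apply/cvgrPdist_lt => e e0.
  by exists e => // q /(_ x a).
by move=> /Gp[e e0 BN]; exists e => // q Bq; exact: BN.
Qed.

(** The boxes with rational sides form a basis. *)
Lemma second_countable_coord : second_countable (T := set_type A).
Proof.
pose B (b : {ffun V * W -> rat * rat}) := [set q : set_type A | forall i,
   ratr (b i).1 < (\val q i.1 i.2 : R) < ratr (b i).2].
exists (range B); first exact: (sub_countable (card_image_le _ _) (countableP _)).
split.
  move=> _ [b _ <-]; rewrite openE => p Bp; rewrite /interior /B /=.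
  apply: (@filter_forall _ (V * W)%type (fun i => [set q : set_type A |
    ratr (b i).1 < (\val q i.1 i.2 : R) < ratr (b i).2]) (nbhs p)) => -[x a].
  have cp := @continuous_coord x a p; have /andP[pl pu] := Bp (x, a).
  have Fl : nbhs p [set q : set_type A | ratr (b (x, a)).1 < (\val q x a : R)].
    exact: (cvgr_gt _ cp _ pl).
  have Fu : nbhs p [set q : set_type A | (\val q x a : R) < ratr (b (x, a)).2].
    exact: (cvgr_lt _ cp _ pu).
  by apply: filterS2 Fl Fu => q /= -> ->.
move=> p N /nbhs_coord[e e0 eN].
have [b bp] : exists b : {ffun V * W -> rat * rat}, forall i,
  [/\ (\val p i.1 i.2 : R) - e < ratr (b i).1, ratr (b i).1 < (\val p i.1 i.2 : R),
  (\val p i.1 i.2 : R) < ratr (b i).2 & ratr (b i).2 < (\val p i.1 i.2 : R) + e].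
  have ex (i : V * W) : exists c : rat * rat,
    [/\ (\val p i.1 i.2 : R) - e < ratr c.1, ratr c.1 < (\val p i.1 i.2 : R),
    (\val p i.1 i.2 : R) < ratr c.2 & ratr c.2 < (\val p i.1 i.2 : R) + e].
    have pl : (\val p i.1 i.2 : R) - e < \val p i.1 i.2 by rewrite ltrBlDr ltrDl.
    have pu : (\val p i.1 i.2 : R) < \val p i.1 i.2 + e by rewrite ltrDl.
    have [l hl] := rat_in_itvoo pl; have [u hu] := rat_in_itvoo pu.
    move: hl hu.
    by rewrite !in_itv /= => /andP[? ?] /andP[? ?]; exists (l, u).
  have [c cP] := choice ex.
  by exists [ffun i => c i] => i; rewrite ffunE; exact: cP.
exists (B b).
  split; first by exists b.
  by move=> i; have [_ -> -> _] := bp i.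
move=> q Bq; apply: eN => x a; have [/= h1 h2 h3 h4] := bp (x, a).
have /andP[/= h5 h6] := Bq (x, a).
by rewrite ltr_norml; apply/andP; split; lra.
Qed.

Lemma open_pos (f : V -> W) :
  open [set q : set_type A | forall x, 0 < (\val q x (f x) : R)].
Proof.
rewrite openE => p fp; rewrite /interior /=.
apply: (@filter_forall _ V (fun x => [set q : set_type A | 0 < (\val q x (f x) : R)]) (nbhs p)) => x.
exact: (cvgr_gt _ (@continuous_coord x (f x) p) _ (fp x)).
Qed.

(** If phi and psi are inverse to each other where the coordinates (x, f x) are
    positive, this region is homeomorphic to its image, which is open because psi
    is continuous. *)
Lemma chart_of_inverses (f : V -> W) (phi : (V -> W -> R) -> R * R)
    (psi : R * R -> V -> W -> R) :
  continuous (fun q : set_type A => phi (\val q)) ->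
  (forall x a, continuous (fun z => psi z x a)) ->
  (forall z, (forall x, 0 < psi z x (f x)) -> A (psi z) /\ phi (psi z) = z) ->
  (forall p, A p -> (forall x, 0 < (p x (f x) : R)) -> psi (phi p) = p) ->
  forall p : set_type A, (forall x, 0 < (\val p x (f x) : R)) ->
  exists U : set (set_type A), exists O : set (R * R),
    [/\ open U, U p, open O & homeomorphic (set_type U) (set_type O)].
Proof.
move=> cphi cpsi phiK psiK p fp.
pose U := [set q : set_type A | forall x, 0 < (\val q x (f x) : R)].
pose O := [set z : R * R | forall x, 0 < psi z x (f x)].
exists U, O; split => //; first exact: open_pos.
  rewrite openE => z fz; rewrite /interior /=.
  apply: (@filter_forall _ V (fun x => [set z : R * R | 0 < psi z x (f x)]) (nbhs z)) => x.
  exact: (cvgr_gt _ (@cpsi x (f x) z) _ (fz x)).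
have Uphi (q : set_type U) : O (phi (\val (\val q))).
  case: q => [[q Aq] /= Uq] x; rewrite psiK; [|exact: set_mem Aq|].
    by move/set_mem: Uq; apply.
  exact: set_mem Uq.
have Apsi (z : set_type O) : A (psi (\val z)).
  by case: z => [z /= /set_mem Oz]; case: (phiK z Oz).
pose h (z : set_type O) : set_type A := exist _ (psi (\val z) : {ptws V -> {ptws W -> R}}) (mem_set (Apsi z)).
have Upsi (z : set_type O) : U (h z).
  by move=> x; exact: (set_mem (valP z)).
pose F (q : set_type U) : set_type O := exist _ (phi (\val (\val q))) (mem_set (Uphi q)).
pose H (z : set_type O) : set_type U := exist (fun q => q \in U) (h z) (mem_set (Upsi z)).
exists F, H; split.
- apply: continuous_set_type => q.
  apply: (@continuous_comp _ _ _ (\val : set_type U -> set_type A)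
    (fun q : set_type A => phi (\val q)) q); last exact: cphi.
  exact: initial_continuous.
- apply: continuous_set_type; apply: continuous_coordP => x a z.
  apply: (@continuous_comp _ _ _ (\val : set_type O -> (R * R)%type)
    (fun z => psi z x a) z); last exact: cpsi.
  exact: initial_continuous.
- case=> [[q Aq] Uq]; apply: val_inj; apply: val_inj => /=.
  by apply: psiK; [exact: set_mem Aq|exact: set_mem Uq].
- case=> [z Oz]; apply: val_inj => /=.
  by case: (phiK z (set_mem Oz)).
Qed.

End SubspaceOfProduct.

(** * Realizations: equations, compactness, connectedness *)

Section HomRealization.
Variables (R : realType) (G : sgraph) (m : nat).
Local Notation K := (HomComplex G (complete_graph m)).

(** The conditions are closed, and the support of p is the smallest cell containing
    it. *)
Lemma hom_realizationP (p : {ptws G -> {ptws complete_graph m -> R}}) :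
  realization_set K p <->
  [/\ forall x a, 0 <= (p x a : R), forall x, \sum_a p x a = 1 &
      forall x y a, edge x y -> p x a * p y a = 0].
Proof.
split.
  move=> [eta]; rewrite inE => /andP[_ /forallP etaE] etap; split.
  - by move=> x a; have [] := etap x.
  - by move=> x; have [] := etap x.
  - move=> x y a exy; have [_ _ px] := etap x; have [_ _ py] := etap y.
    have [ax|/px->] := boolP (a \in eta x); last by rewrite mul0r.
    have [ay|/py->] := boolP (a \in eta y); last by rewrite mulr0.
    move/forallP: (etaE x) => /(_ y) /implyP /(_ exy) /forall_inP /(_ a ax).
    by move=> /forall_inP /(_ a ay); rewrite /= /complete_edge eqxx.
move=> [p0 p1 pe].
exists [ffun x => [set a | p x a != 0]%SET].
  rewrite inE; apply/andP; split.
    apply/forallP => x; rewrite ffunE; apply/negP => /eqP e.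
    have /eqP := p1 x; rewrite big1 ?(negPf (oner_neq0 _)) 1?eq_sym ?oner_eq0 // => a _.
    by move/setP/(_ a): e; rewrite !inE => /negbFE/eqP.
  apply/forallP => x; apply/forallP => y; apply/implyP => exy.
  apply/forall_inP => a; rewrite ffunE inE => pa.
  apply/forall_inP => b; rewrite ffunE inE => pb.
  apply/negP => /eqP e; move: pb; rewrite -e => pb.
  by have /eqP := pe x y a exy; rewrite mulf_eq0 (negPf pa) (negPf pb).
move=> x; split => // a; rewrite ffunE inE negbK => /eqP //.
Qed.

End HomRealization.

Section CompactRealization.
Variables (R : realType) (V W : finType) (K : {set {ffun V -> {set W}}}) (E : rel V).
Hypothesis KP : forall p : {ptws V -> {ptws W -> R}}, realization_set K p <->
  [/\ forall x a, 0 <= (p x a : R), forall x, \sum_a p x a = 1 &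
      forall x y a, E x y -> p x a * p y a = 0].

Lemma realization_mem (q : realization R K) :
  [/\ forall x a, 0 <= (\val q x a : R), forall x, \sum_a (\val q x a : R) = 1 &
      forall x y a, E x y -> (\val q x a : R) * \val q y a = 0].
Proof. by apply/KP; apply: set_mem; exact: valP. Qed.

Lemma realization_coord01 (q : realization R K) x a : 0 <= (\val q x a : R) <= 1.
Proof.
have [q0 q1 _] := realization_mem q.
by rewrite q0 /= -(q1 x) (bigD1 a) //= lerDl; apply: sumr_ge0 => b _; exact: q0.
Qed.

Lemma realization_compact : compact [set: realization R K].
Proof.
apply: compact_coord => [q x a|F l PF Fl]; first exact: realization_coord01.
apply/KP; split.
- move=> x a; apply: (@closed_cvg _ _ F PF (fun q : realization R K => (\val q x a : R))
    [set t : R | 0 <= t] (@closed_ge R 0) _ (l x a) (Fl x a)).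
  by apply: nearW => q; have /andP[] := @realization_coord01 q x a.
- move=> x; have cs : (fun q : realization R K => \sum_a (\val q x a : R)) @ F --> \sum_a l x a.
    have ac : continuous (fun z : R * R => z.1 + z.2) by exact: add_continuous.
    apply: (@cvg_big R _ +%R 0 xpredT ac _ F _
      (fun a (q : realization R K) => (\val q x a : R)) (l x)) => a _; exact: Fl.
  apply: (@cvg_unique _ (@Rhausdorff R) _ _ _ _ cs).
  apply: cvg_near_cst; apply: nearW => q /=.
  by have [_ q1 _] := realization_mem q; rewrite q1.
- move=> x y a exy.
  have cs : (fun q : realization R K => (\val q x a : R) * \val q y a) @ F -->
      l x a * l y a by apply: cvgM; exact: Fl.
  apply: (@cvg_unique _ (@Rhausdorff R) _ _ _ _ cs).
  apply: cvg_near_cst; apply: nearW => q /=.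
  by have [_ _ q2] := realization_mem q; rewrite q2.
Qed.

End CompactRealization.

Section CellConnected.
Variables (R : realType) (V W : finType) (K : {set {ffun V -> {set W}}}).

(** A cell is convex.  Cutting t off at 0 and 1 makes the segment a map defined on
    the whole line, which is connected. *)
Lemma cell_connected (p q : realization R K) (eta : {ffun V -> {set W}}) :
  eta \in K -> (forall x, simplex_face (eta x) (\val p x)) ->
  (forall x, simplex_face (eta x) (\val q x)) ->
  connected_component [set: realization R K] p q.
Proof.
move=> etaK pe qe.
pose s (t : R) := Num.min (Num.max t 0) 1.
have s01 t : 0 <= s t <= 1.
  by rewrite /s le_min ge_min lexx orbT le_max lexx orbT ler01.
pose c (t : R) : V -> W -> R := fun x a => (1 - s t) * \val p x a + s t * \val q x a.
have cK t : realization_set K (c t : {ptws V -> {ptws W -> R}}).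
  exists eta => // x; have [p0 p1 pz] := pe x; have [q0 q1 qz] := qe x.
  have /andP[t0 t1] := s01 t; split.
  - by move=> a; rewrite addr_ge0 // mulr_ge0 // subr_ge0.
  - by rewrite big_split /= -!mulr_sumr p1 q1 !mulr1 subrK.
  - by move=> a aN; rewrite /c pz // qz // !mulr0 addr0.
pose d t : realization R K := exist _ (c t : {ptws V -> {ptws W -> R}}) (mem_set (cK t)).
have sc : continuous s.
  move=> t; have h : {for t, continuous (fun u : R => Num.max u 0)}.
    by apply: (@continuous_max R R id (fun=> 0)); [exact: cvg_id|exact: cvg_cst].
  exact: (@continuous_min R R _ (fun=> 1) t h (@cvg_cst _ _ _ _ _)).
have dc : continuous d.
  apply: continuous_coordP => x a t.
  have h1 : (fun u => s u * \val q x a) @ t --> s t * \val q x a.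
    by apply: cvgM; [exact: sc|exact: cvg_cst].
  have h2 : (fun u => (1 - s u) * \val p x a) @ t --> (1 - s t) * \val p x a.
    by apply: cvgM; [apply: cvgB; [exact: cvg_cst|exact: sc]|exact: cvg_cst].
  exact: (cvgD h2 h1).
have d0 : d 0 = p.
  apply: coord_inj => x a /=; rewrite /c /s maxxx min_l ?ler01 //.
  by rewrite subr0 mul1r mul0r addr0.
have d1 : d 1 = q.
  apply: coord_inj => x a /=; rewrite /c /s max_l ?ler01 // minxx.
  by rewrite subrr mul1r mul0r add0r.
exists (d @` setT); last by exists 1.
split => //; first by exists 0.
apply: connected_continuous_connected; first exact/connected_intervalP.
exact: continuous_subspaceT.
Qed.

Definition vertex_point (f : V -> W) : {ptws V -> {ptws W -> R}} :=
  fun x a => (a == f x)%:R.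

Lemma vertex_point_face (f : V -> W) (eta : {ffun V -> {set W}}) :
  (forall x, f x \in eta x) -> forall x, simplex_face (eta x) (vertex_point f x).
Proof.
move=> fe x; split => [a||a aN]; rewrite /vertex_point ?ler0n //.
  by rewrite (bigD1 (f x)) //= eqxx big1 ?addr0 // => b /negPf ->.
by case: eqP aN => // ->; rewrite fe.
Qed.

Lemma vertex_point_in (f : V -> W) : vertex_cell f \in K ->
  realization_set K (vertex_point f).
Proof.
by move=> fK; exists (vertex_cell f) => //; apply: vertex_point_face => x; rewrite ffunE set11.
Qed.

(** Every point is joined inside its cell to a vertex, and the connected component
    is an invariant of the vertices along cells. *)
Lemma realization_connected :
  (forall eta tau : {ffun V -> {set W}}, eta \in K -> (forall x, tau x != finset.set0) ->
     (forall x, tau x \subset eta x) -> tau \in K) ->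
  (forall (T : Type) (h : {ffun V -> W} -> T),
    (forall (f g : {ffun V -> W}) eta, eta \in K -> (forall x, f x \in eta x) ->
       (forall x, g x \in eta x) -> h f = h g) ->
    forall f g : {ffun V -> W}, vertex_cell f \in K -> vertex_cell g \in K -> h f = h g) ->
  connected [set: realization R K].
Proof.
move=> Kdown Kconn.
pose h (f : {ffun V -> W}) := [set q : realization R K |
  exists2 p : realization R K, \val p = vertex_point f &
    connected_component [set: realization R K] p q].
have hE (f g : {ffun V -> W}) : vertex_cell f \in K -> vertex_cell g \in K -> h f = h g.
  apply: Kconn => {}f {}g eta etaK fe ge.
  have in1 (k : {ffun V -> W}) : (forall x, k x \in eta x) ->
      realization_set K (vertex_point k).
    move=> ke; apply: vertex_point_in; apply: (Kdown eta) => // x.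
      by rewrite ffunE; apply/set0Pn; exists (k x); rewrite set11.
    by rewrite ffunE finset.sub1set.
  pose pt (k : {ffun V -> W}) (ke : forall x, k x \in eta x) : realization R K := exist _ (vertex_point k) (mem_set (in1 k ke)).
  have sub (k l : {ffun V -> W}) (ke : forall x, k x \in eta x)
      (le : forall x, l x \in eta x) : h k `<=` h l.
    move=> q [p pk pq]; exists (pt l le) => //.
    apply: connected_component_trans pq.
    apply: (cell_connected etaK); first exact: vertex_point_face.
    by rewrite pk; exact: vertex_point_face.
  by apply/seteqP; split; exact: sub.
have hT (q : realization R K) : exists2 f : {ffun V -> W}, vertex_cell f \in K & h f q.
  have [eta etaK qe] := set_mem (valP q).
  have eta0 x : exists a, a \in eta x.
    apply/set0Pn; apply/negP => /eqP e; have [_ s1 z] := qe x.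
    move/eqP: s1; rewrite big1 1?eq_sym ?oner_eq0 // => a _.
    by apply: z; rewrite e inE.
  have [f fe] := choice eta0.
  have fK : vertex_cell (finfun f) \in K.
    apply: (Kdown eta) => // x; rewrite !ffunE.
      by apply/set0Pn; exists (f x); rewrite set11.
    by rewrite finset.sub1set.
  exists (finfun f) => //.
  exists (exist _ (vertex_point (finfun f)) (mem_set (vertex_point_in fK))) => //.
  apply: (cell_connected etaK) => //; apply: vertex_point_face => x.
  by rewrite ffunE.
have [->|/set0P[p _]] := eqVneq [set: realization R K] set0; first exact: connected0.
have -> : [set: realization R K] = connected_component [set: realization R K] p.
  apply/seteqP; split => // q _.
  have [f fK [p' p'f hp]] := hT p; have [g gK [q' q'g hq]] := hT q.
  have : h f q by rewrite (hE f g) //; exists q'.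
  move=> [p'' p''f hq'].
  have e : p' = p'' by apply: val_inj; rewrite p'f p''f.
  apply: connected_component_trans hq'; rewrite -e.
  exact: connected_component_sym.
exact: component_connected.
Qed.

End CellConnected.


(** * The cone over a cycle is a plane *)

Lemma continuous_positive_part (R : realType) (T : topologicalType) (g : T -> R) :
  continuous g -> continuous (fun t => Num.max (g t) 0).
Proof.
by move=> cg t; exact: (@continuous_max R _ g (fun=> 0) t (cg t) (@cvg_cst _ _ _ _ _)).
Qed.

Section Cone.
Variable R : realType.

(** The nonnegative functions on the vertices of the cycle 0, 1, ..., m-1 supported on
    a vertex or an edge, extended by 0. *)
Definition cone m (q : nat -> R) :=
  [/\ forall i, 0 <= q i, forall i, (m <= i)%N -> q i = 0 &
     forall i j, (i < j < m)%N -> j != i.+1 -> (i != 0%N) || (j != m.-1) ->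
       q i = 0 \/ q j = 0].

(** F restricts to a homeomorphism from the cone to the plane with inverse H.
    Continuity of F is stated along maps into the function space, so that no
    topology on sequences is involved. *)
Definition plane_model m (F : (nat -> R) -> R * R) (H : R * R -> nat -> R) :=
  [/\ forall (T : topologicalType) (c : T -> nat -> R),
        (forall i, continuous (c ^~ i)) -> continuous (F \o c),
      forall i, continuous (H ^~ i),
      forall z, cone m (H z),
      cancel H F &
      forall q, cone m q -> H (F q) = q].

(** The four quadrants. *)
Lemma cone4 : plane_model 4
  (fun q => (q 0%N - q 2%N, q 1%N - q 3%N))
  (fun z i => if i == 0%N then Num.max z.1 0 else if i == 1%N then Num.max z.2 0
     else if i == 2%N then Num.max (- z.1) 0 else if i == 3%N then Num.max (- z.2) 0
     else 0).
Proof.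
split.
- move=> T c cc t.
  have h i j : (fun u => c u i - c u j) @ t --> c t i - c t j.
    by apply: cvgB; exact: cc.
  exact: (cvg_pair (h 0%N 2%N) (h 1%N 3%N)).
- have cfst : continuous (fun z : R * R => z.1) by move=> z; exact: cvg_fst.
  have csnd : continuous (fun z : R * R => z.2) by move=> z; exact: cvg_snd.
  case=> [|[|[|[|i]]]].
  + exact: continuous_positive_part cfst.
  + exact: continuous_positive_part csnd.
  + by apply: continuous_positive_part => z; apply: cvgN; exact: cfst.
  + by apply: continuous_positive_part => z; apply: cvgN; exact: csnd.
  by move=> z; exact: cvg_cst.
- move=> z; split.
  + by case=> [|[|[|[|i]]]] //=; rewrite le_max lexx orbT.
  + by case=> [|[|[|[|i]]]].
  + case=> [|[|[|[|i]]]] [|[|[|[|j]]]] //= _ _ _; try (by right); try (by left).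
      by case: (lerP z.1 0) => h; [left|right]; rewrite ?max_r // oppr_le0 ltW.
    by case: (lerP z.2 0) => h; [left|right]; rewrite ?max_r // oppr_le0 ltW.
- by case=> x y /=; congr pair; rewrite !maxEle; do 2! case: ifP; lra.
- move=> q [q0 qz qe]; apply/funext; case=> [|[|[|[|i]]]] /=; last by rewrite qz.
  + by rewrite maxEle; case: (qe 0%N 2%N) => // -> ; case: ifP; have := q0 0%N; have := q0 2%N; lra.
  + by rewrite maxEle; case: (qe 1%N 3%N) => // -> ; case: ifP; have := q0 1%N; have := q0 3%N; lra.
  + by rewrite maxEle; case: (qe 0%N 2%N) => // -> ; case: ifP; have := q0 0%N; have := q0 2%N; lra.
  + by rewrite maxEle; case: (qe 1%N 3%N) => // -> ; case: ifP; have := q0 1%N; have := q0 3%N; lra.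
Qed.

(** Subdivide the edge between m-1 and 0 by the new vertex m, placed at the sum of its
    ends.  Merging adds the coordinate of m to both ends; splitting takes off the
    minimum of the two end coordinates and gives it to m. *)
Lemma coneS m F H : (4 <= m)%N -> plane_model m F H ->
  exists F' H', plane_model m.+1 F' H'.
Proof.
move=> m4 [Fc Hc Hm HK FK].
pose E i := (i == 0%N) || (i == m.-1).
(* M merges and S splits. *)
pose M (q : nat -> R) i := if i == m then 0 else if E i then q i + q m else q i.
pose mu (q : nat -> R) := Num.min (q 0%N) (q m.-1).
pose S (q : nat -> R) i := if i == m then mu q else if E i then q i - mu q else q i.
have m0 : (0 != m)%N by lia.
have E0 : E 0%N by [].
have Em : E m.-1 by rewrite /E eqxx orbT.
have mE : m.-1 == m = false by lia.
have mu_ge q : cone m q -> 0 <= mu q by case=> q0 _ _; rewrite /mu le_min !q0.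
have S_le q i : cone m q -> S q i != 0 -> i != m -> q i != 0.
  move=> cq; rewrite /S; have [//|_] := eqVneq i m; case: ifP => // Ei Sq _.
  have qm := mu_ge _ cq; have [q0 _ _] := cq; apply: contraNneq Sq => qi.
  have : mu q <= q i by case/orP: Ei => /eqP ->; rewrite /mu ge_min lexx ?orbT.
  by rewrite qi => ?; rewrite sub0r oppr_eq0; apply/eqP/le_anti/andP.
have mu_neq q : cone m q -> mu q != 0 -> q 0%N != 0 /\ q m.-1 != 0.
  move=> cq muq; have [q0 _ _] := cq.
  by split; apply: contraNneq muq => e; apply/eqP/le_anti;
    rewrite mu_ge // andbT /mu ge_min e lexx ?orbT.
have coneN n q i j : cone n q -> (i < j < n)%N -> j != i.+1 ->
    (i != 0%N) || (j != n.-1) -> q i != 0 -> q j != 0 -> False.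
  move=> [_ _ qe] ij nij bd /eqP qi /eqP qj.
  by case: (qe i j).
have coneSq q : cone m q -> cone m.+1 (S q).
  move=> cq; have := cq; case=> q0 qz qe; split.
  - move=> i; rewrite /S; case: ifP => _; first exact: mu_ge.
    case: ifP => // /orP[] /eqP ->; rewrite subr_ge0 /mu ge_min lexx ?orbT //.
  - move=> i im; rewrite /S /E; do 2! (case: ifP => [|_]; first lia).
    by apply: qz; lia.
  - move=> i j /andP[ij jm] nij bd.
    have [->|Sqi] := eqVneq (S q i) 0; first by left.
    have [->|Sqj] := eqVneq (S q j) 0; first by right.
    exfalso.
    have qi : q i != 0 by apply: S_le => //; lia.
    have [jm'|jm'] := eqVneq j m.
      move: Sqj; rewrite jm' /S eqxx => /(mu_neq _ cq)[q00 qm1].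
      have i1 : i == 1%N.
        by apply/negP => /negP i1; apply: (coneN _ _ _ _ cq _ i1 _ q00 qi); lia.
      by apply: (coneN _ _ i m.-1 cq _ _ _ qi qm1); lia.
    have qj : q j != 0 by apply: S_le.
    have [/andP[/eqP i0 /eqP jm1]|bd'] := boolP ((i == 0%N) && (j == m.-1)).
      move: Sqi Sqj; rewrite i0 jm1 /S (negPf m0) mE E0 Em /mu minEle.
      by case: ifP; rewrite ?subrr ?eqxx.
    by apply: (coneN _ _ _ _ cq _ nij _ qi qj); lia.
have coneM q : cone m.+1 q -> cone m (M q).
  move=> cq; have := cq; case=> q0 qz qe; split.
  - by move=> i; rewrite /M; do 2! case: ifP => // _; rewrite addr_ge0.
  - move=> i im; rewrite /M; case: eqP => // im'; case: ifP; rewrite /E; first lia.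
    by move=> _; apply: qz; lia.
  - move=> i j /andP[ij jm] nij bd.
    have [->|Mi] := eqVneq (M q i) 0; first by left.
    have [->|Mj] := eqVneq (M q j) 0; first by right.
    exfalso.
    have Mq k : M q k != 0 -> (q k != 0) || (E k && (q m != 0)).
      rewrite /M; case: ifP => [_|_]; first by rewrite eqxx.
      case: ifP => [_|_ ->//]; apply: contraNT; rewrite negb_or !negbK.
      by move=> /andP[/eqP -> /eqP ->]; rewrite addr0.
    have qm k : (0 < k < m.-1)%N -> q k != 0 -> q m != 0 -> False.
      by move=> km; apply: (coneN _ _ _ _ cq); lia.
    move: (Mq i Mi) (Mq j Mj) => /orP[qi|/andP[Ei qim]] /orP[qj|/andP[Ej qjm]].
    + by apply: (coneN _ _ _ _ cq _ nij _ qi qj); lia.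
    + by apply: (qm i) => //; rewrite /E in Ej; lia.
    + by apply: (qm j) => //; rewrite /E in Ei; lia.
    + by rewrite /E in Ei Ej; lia.
have SK q : cone m q -> M (S q) = q.
  move=> [q0 qz _]; apply/funext => i; rewrite /M /S.
  have [->|im] := eqVneq i m; first by rewrite qz.
  by rewrite eqxx; case: (E i); rewrite ?subrK.
have MK q : cone m.+1 q -> S (M q) = q.
  move=> cq; have := cq; move=> [q0 qz qe].
  have muM : mu (M q) = q m.
    rewrite /mu /M (negPf m0) mE E0 Em.
    case: (qe 0%N m.-1) => [|||->|->]; try lia; rewrite add0r.
      by rewrite min_l // lerDr.
    by rewrite min_r // lerDr.
  apply/funext => i; rewrite /S muM /M.
  have [->//|im] := eqVneq i m.
  by case: (E i); rewrite ?addrK.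
exists (F \o M), (S \o H) => //; split.
- move=> T c cc; apply: (Fc T (fun t => M (c t))) => i t; rewrite /M.
  case: (i == m); first exact: cvg_cst.
  by case: (E i); [apply: cvgD; exact: cc|exact: cc].
- have cmu : continuous (fun z => mu (H z)).
    by move=> z; exact: (@continuous_min R _ (H ^~ 0%N) (H ^~ m.-1) z (Hc _ z) (Hc _ z)).
  move=> i z; rewrite /S /=; case: (i == m); first exact: cmu.
  by case: (E i); [apply: cvgB; [exact: Hc|exact: cmu]|exact: Hc].
- by move=> z; exact: coneSq.
- by move=> z /=; rewrite SK ?HK.
- by move=> q cq /=; rewrite FK ?MK //; exact: coneM.
Qed.

Lemma cone_plane m : (4 <= m)%N -> exists F H, plane_model m F H.
Proof.
elim: m => // m IH; rewrite leq_eqVlt => /predU1P[<-|m4].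
  by do 2! eexists; exact: cone4.
by have [F [H FH]] := IH m4; exact: coneS FH.
Qed.

End Cone.

(** * Charts *)

Section Charts.
Variables (R : realType) (r : nat) (hr : (2 <= r)%N).
Local Notation n := (2 * r)%N.
Local Notation V := 'I_n.
Local Notation W := 'I_r.+1.
Local Notation K := (coloring_complex r).
Local Notation space := (realization R K).
Implicit Types (f : {ffun V -> W}) (x y u v : V) (a b c e : W).

Lemma coloring_realizationP (p : {ptws V -> {ptws W -> R}}) :
  realization_set K p <->
  [/\ forall x a, 0 <= (p x a : R), forall x, \sum_a p x a = 1 &
      forall x y a, ~~ touch x y -> p x a * p y a = 0].
Proof.
rewrite coloring_complex.unlock.
have hP := @hom_realizationP R (complement (cycle_graph n)) r.+1 p.
split => [/hP[p0 p1 pe]|[p0 p1 pe]].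
  by split => // x y a xy; apply: pe; rewrite complement_cycleE.
by apply/hP; split => // x y a; rewrite complement_cycleE; exact: pe.
Qed.

(** Around the vertex f a point is determined by its entries off the graph of f, as
    the rows have sum 1.  So a chart amounts to a parametrization off of these
    entries by the plane, compatible with the clique conditions, and to a map phi
    that recovers the parameters. *)
Lemma off_vertex_chart f (phi : (V -> W -> R) -> R * R) (off : R * R -> V -> W -> R) :
  valid f ->
  continuous (fun q : space => phi (\val q)) ->
  (forall x e, continuous (fun z => off z x e)) ->
  (forall z x e, 0 <= off z x e) ->
  (forall z x, off z x (f x) = 0) ->
  (forall z x y e, ~~ touch x y -> off z x e * off z y e = 0) ->
  (forall z x y, ~~ touch x y -> off z y (f x) = 0) ->
  (forall z (q : V -> W -> R), (forall x e, e != f x -> q x e = off z x e) -> phi q = z) ->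
  (forall p : {ptws V -> {ptws W -> R}}, realization_set K p ->
     (forall x, 0 < (p x (f x) : R)) -> forall x e, e != f x -> p x e = off (phi p) x e) ->
  forall p : space, (forall x, 0 < (\val p x (f x) : R)) ->
  exists U : set space, exists O : set (R * R),
    [/\ open U, U p, open O & homeomorphic (set_type U) (set_type O)].
Proof.
move=> vf cphi coff off0 off_diag off_clique off_f phiK offK.
pose psi z x e := off z x e + (e == f x)%:R * (1 - \sum_b off z x b).
have psiE z x e : e != f x -> psi z x e = off z x e.
  by move=> /negPf ex; rewrite /psi ex mul0r addr0.
have psi_diag z x : psi z x (f x) = 1 - \sum_b off z x b.
  by rewrite /psi eqxx mul1r off_diag add0r.
apply: (chart_of_inverses (f := f) (phi := phi) (psi := psi)) => //.
- move=> x e z; rewrite /psi.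
  have ac : continuous (fun z : R * R => z.1 + z.2) by exact: add_continuous.
  have h1 : (fun z => \sum_b off z x b) @ z --> \sum_b off z x b.
    apply: (@cvg_big R _ +%R 0 xpredT ac _ (nbhs z) _ (fun b z => off z x b)) => b _; exact: coff.
  have h2 : (fun z => (e == f x)%:R * (1 - \sum_b off z x b)) @ z -->
      (e == f x)%:R * (1 - \sum_b off z x b).
    by apply: cvgM; [exact: cvg_cst|apply: cvgB; [exact: cvg_cst|exact: h1]].
  exact: (cvgD (@coff x e z) h2).
- move=> z zpos; split; last by apply: phiK => x e; exact: psiE.
  apply/coloring_realizationP; split.
  + move=> x e; have [->|ex] := eqVneq e (f x); first exact: ltW.
    by rewrite psiE.
  + move=> x; have s1 : \sum_e (e == f x)%:R = 1 :> R.
      by rewrite (bigD1 (f x)) //= eqxx big1 ?addr0 // => e /negPf ->.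
    by rewrite big_split /= -mulr_suml s1 mul1r addrC subrK.
  + move=> x y e xy.
    have [ex|ex] := eqVneq e (f x); have [ey|ey] := eqVneq e (f y).
    * by case/negP: xy; apply: (validP _ vf); rewrite -ex.
    * by rewrite [psi z y e]psiE // ex off_f // mulr0.
    * by rewrite [psi z x e]psiE // ey off_f ?mul0r // touch_sym.
    * by rewrite !psiE // off_clique.
- move=> p pA ppos; apply/funext => x; apply/funext => e.
  have [->|ex] := eqVneq e (f x); last by rewrite psiE // -offK.
  have [p0 p1 _] := (coloring_realizationP p).1 pA.
  rewrite psi_diag -(p1 x) (bigD1 (f x)) //= [\sum_b off _ _ _](bigD1 (f x)) //= off_diag add0r.
  by rewrite [X in _ - X](eq_bigr (fun b => p x b)) ?addrK // => b bx; rewrite -offK.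
Qed.

Lemma touch_pair x y : touch x y -> touch x (ordS y) -> x = y \/ x = ordS y.
Proof.
rewrite [touch x y]touch_sym touchE !inE => /or3P[/eqP|/eqP|/eqP ->]; [by left|by right|].
by rewrite touch_sym touch_ordS_pred.
Qed.

(** A color used twice by f is already on an edge of the cycle and cannot extend. *)
Lemma full_column f y (p : {ptws V -> {ptws W -> R}}) :
  realization_set K p -> (forall x, 0 < (p x (f x) : R)) -> f (ordS y) = f y ->
  forall x, f y != f x -> p x (f y) = 0 :> R.
Proof.
move=> /coloring_realizationP[_ _ pe] ppos fy x fxy.
have near_of z : f z = f y -> p x (f y) != 0 :> R -> touch x z.
  move=> fz px; apply: contraT => nt; have /eqP := pe x z (f y) nt.
  by rewrite mulf_eq0 (negPf px) /= -fz (gt_eqF (ppos z)).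
apply/eqP; apply: contraNT fxy => px.
by case: (touch_pair (near_of y erefl px) (near_of (ordS y) fy px)) => ->; rewrite ?fy.
Qed.

Lemma missing_full f c : valid f -> (forall x, f x != c) ->
  forall e, e != c -> exists y, f y = e /\ f (ordS y) = e.
Proof.
move=> vf fc e ec.
have fK : vertex_cell f \in K by rewrite vertex_cell_valid.
have c0 : #|column (vertex_cell f) c| = 0%N.
  by apply: eq_card0 => x; rewrite column_vertex finset.inE (negPf (fc x)).
have e2 : #|column (vertex_cell f) e| = 2%N.
  have := deficit2_le hr fK ec; rewrite c0 vertex_cell_dim.
  by have := card_column_le2 hr e fK; case: #|_| => [|[|[|]]].
have inE' y : (y \in column (vertex_cell f) e) = (f y == e) by rewrite column_vertex finset.inE.
case: (clique_form hr (complex_col e fK)) => [E|[y E]|[y E]]; rewrite E ?finset.cards0 ?finset.cards1 // in e2.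
exists y; have := inE' y; have := inE' (ordS y); rewrite E !finset.inE !eqxx orbT.
by move=> /esym/eqP ? /esym/eqP.
Qed.

(** The column of c as a sequence, a point of the cone over the cycle. *)
Definition column_seq (p : V -> W -> R) c (i : nat) : R :=
  if insub i is Some x then p x c else 0.

Lemma column_seq_ord p c x : column_seq p c x = p x c.
Proof. by rewrite /column_seq valK. Qed.

Lemma column_seq_out p c i : (n <= i)%N -> column_seq p c i = 0.
Proof. by move=> ni; rewrite /column_seq insubF // ltnNge ni. Qed.

(** All colors but the missing color c are used twice, so the chart is the column of
    c, read in the cone over the cycle. *)
Lemma chart_missing f : valid f -> missing f ->
  forall p : space, (forall x, 0 < (\val p x (f x) : R)) ->
  exists U : set space, exists O : set (R * R),
    [/\ open U, U p, open O & homeomorphic (set_type U) (set_type O)].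
Proof.
move=> vf /missingP[c fc].
have n4 : (4 <= n)%N by lia.
have [F [H [Fc Hc Hcone HK FK]]] := cone_plane R n4.
have cone_touch q x y : cone n q -> ~~ touch x y -> q x * q y = 0 :> R.
  move=> [q0 qz qe].
  wlog xy : x y / (x < y)%N => [hw nxy|].
    case: (ltngtP x y) => [xy|xy|/ord_inj xy]; first exact: hw.
      by rewrite mulrC; apply: hw => //; rewrite touch_sym.
    by rewrite xy touch_refl in nxy.
  move=> nxy; have [|||->|->] := qe x y; rewrite ?mulr0 ?mul0r ?xy ?ltn_ord //.
    apply: contraNneq nxy => yx; rewrite (_ : y = ordS x) ?touch_ordS //.
    apply: ord_inj; rewrite val_ordS // yx; case: eqP => // e.
    by have := ltn_ord y; rewrite yx e ltnn.
  rewrite -negb_and; apply: contra nxy => /andP[/eqP x0 /eqP y1].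
  rewrite (_ : x = ordS y) ?touch_ordS 1?touch_sym ?touch_ordS //.
  by apply: ord_inj; rewrite val_ordS // x0 y1 prednK ?eqxx //; lia.
pose off z x e : R := if e == c then H z x else 0.
have coneP (p : {ptws V -> {ptws W -> R}}) : realization_set K p -> cone n (column_seq p c).
  move=> /coloring_realizationP[p0 _ pe]; split.
  - by move=> i; rewrite /column_seq; case: insub => // x; exact: p0.
  - by move=> i; exact: column_seq_out.
  - move=> i j /andP[ij jn] nji bd; have jn' := ltn_trans ij jn.
    have -> : i = Ordinal jn' by []. have -> : j = Ordinal jn by [].
    rewrite !column_seq_ord; have /eqP : p (Ordinal jn') c * p (Ordinal jn) c = 0.
      apply: pe; apply/negP => /or3P[] /eqP /(congr1 (@nat_of_ord n)).
      + by rewrite /= => e; rewrite e ltnn in ij.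
      + rewrite val_ordS //=; case: ifP => _ e; first by rewrite e in ij.
        by rewrite e eqxx in nji.
      + rewrite val_ordS //=; case: ifP => [/eqP jn1|_] e; first by move: bd; rewrite e -jn1 /= eqxx.
        by rewrite e ltnNge leqnSn in ij.
    by rewrite mulf_eq0 => /orP[/eqP|/eqP]; [left|right].
apply: (off_vertex_chart (f := f) (phi := fun p => F (column_seq p c)) (off := off)) => //.
- apply: (Fc _ (fun q : space => column_seq (\val q) c)) => i.
  rewrite /column_seq; case: (insub i : option V) => [x|].
    exact: continuous_coord.
  exact: (@cst_continuous space R 0).
- move=> x e z; rewrite /off; case: (e == c); [exact: Hc|exact: cvg_cst].
- by move=> z x e; rewrite /off; case: ifP => // _; have [h0 _ _] := Hcone z; exact: h0.
- by move=> z x; rewrite /off (negPf (fc x)).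
- move=> z x y e xy; rewrite /off; case: ifP => _; last by rewrite mul0r.
  exact: cone_touch.
- by move=> z x y xy; rewrite /off (negPf (fc x)).
- move=> z q qE; rewrite -[RHS]HK; congr F; apply/funext => i.
  have [ni|ni] := leqP n i.
    by rewrite column_seq_out //; have [_ h _] := Hcone z; rewrite h.
  by rewrite -[i]/(val (Ordinal ni)) column_seq_ord qE /off ?eqxx // eq_sym fc.
- move=> p pA ppos x e ex; rewrite /off; have [->|ec] := eqVneq e c.
    by rewrite FK ?column_seq_ord //; exact: coneP.
  have [y [ye ySe]] : exists y, f y = e /\ f (ordS y) = e.
    by apply: missing_full ec.
  by rewrite -ye; apply: full_column => //; rewrite ?ye // eq_sym.
Qed.

(** A color used once, at u, extends to the successor of u for t > 0 and to its
    predecessor for t < 0. *)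
Definition fork u x (t : R) : R :=
  if x == ordS u then Num.max t 0 else if x == ord_pred u then Num.max (- t) 0 else 0.

Lemma fork_continuous u x (g : R * R -> R) : continuous g -> continuous (fun z => fork u x (g z)).
Proof.
move=> cg; rewrite /fork; case: (x == ordS u); first exact: continuous_positive_part.
case: (x == ord_pred u); last by move=> z; exact: cvg_cst.
by apply: continuous_positive_part => z; apply: cvgN; exact: cg.
Qed.

Lemma fork_ge0 u x t : 0 <= fork u x t.
Proof. by rewrite /fork; case: ifP => _; [|case: ifP => // _]; rewrite le_max lexx orbT. Qed.

Lemma fork_touch u x t : ~~ touch u x -> fork u x t = 0.
Proof.
by rewrite /fork touchE !inE !negb_or => /and3P[_ /negPf -> /negPf ->].
Qed.

Lemma fork_center u t : fork u u t = 0.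
Proof.
by rewrite /fork eq_sym (negPf (ordS_neq hr u)) -{1}[u]ord_predK (negPf (ordS_neq hr _)).
Qed.

Lemma fork_clique u x y t : ~~ touch x y -> fork u x t * fork u y t = 0.
Proof.
move=> xy; rewrite /fork.
case: (eqVneq x (ordS u)) => [xS|xS]; case: (eqVneq y (ordS u)) => [yS|yS].
- by rewrite xS yS touch_refl in xy.
- case: eqP => _; last by rewrite mulr0.
  by rewrite !maxEle; do 2! case: ifP; nra.
- case: eqP => _; last by rewrite mul0r.
  by rewrite !maxEle; do 2! case: ifP; nra.
- case: (eqVneq x (ord_pred u)) => [xp|xp]; last by rewrite mul0r.
  case: (eqVneq y (ord_pred u)) => [yp|yp]; last by rewrite mulr0.
  by rewrite xp yp touch_refl in xy.
Qed.

Lemma fork_sub u t : fork u (ordS u) t - fork u (ord_pred u) t = t.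
Proof.
rewrite /fork eqxx [ord_pred u == _]eq_sym (negPf (ordS_neq_pred hr u)) eqxx.
by rewrite !maxEle; do 2! case: ifP; lra.
Qed.

Lemma single_column f u (p : {ptws V -> {ptws W -> R}}) :
  realization_set K p -> (forall x, 0 < (p x (f x) : R)) ->
  forall x, f u != f x -> p x (f u) = fork u x (p (ordS u) (f u) - p (ord_pred u) (f u)) :> R.
Proof.
move=> /coloring_realizationP[p0 _ pe] ppos x fux.
have [ux|ux] := boolP (touch u x); last first.
  rewrite fork_touch //; have /eqP := pe u x (f u) ux.
  by rewrite mulf_eq0 (gt_eqF (ppos u)) => /eqP.
have := pe (ordS u) (ord_pred u) (f u); rewrite touch_ordS_pred // => /(_ isT) sp.
have S0 := p0 (ordS u) (f u); have P0 := p0 (ord_pred u) (f u).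
move: ux; rewrite touchE !inE => /or3P[/eqP xu|/eqP ->|/eqP ->].
- by rewrite xu eqxx in fux.
- rewrite /fork eqxx maxEle; move/eqP: sp; rewrite mulf_eq0.
  by move=> /orP[/eqP->|/eqP->]; case: ifP; lra.
- rewrite /fork eq_sym (negPf (ordS_neq_pred hr u)) eqxx maxEle; move/eqP: sp; rewrite mulf_eq0.
  by move=> /orP[/eqP->|/eqP->]; case: ifP; lra.
Qed.

(** The chart consists of the two parameters of the colors used once. *)
Lemma chart_surjective f : valid f -> ~~ missing f ->
  forall p : space, (forall x, 0 < (\val p x (f x) : R)) ->
  exists U : set space, exists O : set (R * R),
    [/\ open U, U p, open O & homeomorphic (set_type U) (set_type O)].
Proof.
move=> vf mf.
have [u [uo su uu]] := surjective_single hr false vf mf.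
have [v [vo sv vv]] := surjective_single hr true vf mf.
have uv : f v == f u = false.
  by apply/eqP => /(singleP _ _ su) e; move: vo; rewrite e uo.
pose off (z : R * R) x e : R := if e == f u then fork u x z.1 else if e == f v then fork v x z.2 else 0.
pose phi (p : V -> W -> R) := (p (ordS u) (f u) - p (ord_pred u) (f u),
                               p (ordS v) (f v) - p (ord_pred v) (f v)).
have neqS w : single f w -> f w != f (ordS w).
  by move=> /singleP sw; apply/eqP => e; have /eqP := sw _ (esym e); rewrite (negPf (ordS_neq hr w)).
have neqP w : single f w -> f w != f (ord_pred w).
  move=> /singleP sw; apply/eqP => e; have := sw _ (esym e) => E.
  by have := odd_ord_pred hr w; rewrite E; case: odd.
apply: (off_vertex_chart (f := f) (phi := phi) (off := off)) => //.
- move=> q; rewrite /phi.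
  have h x y a : (fun q : space => (\val q x a : R) - \val q y a) @ q --> (\val q x a : R) - \val q y a.
    exact: (cvgB (@continuous_coord R V W _ x a q) (@continuous_coord R V W _ y a q)).
  exact: (cvg_pair (h (ordS u) (ord_pred u) (f u)) (h (ordS v) (ord_pred v) (f v))).
- move=> x e; rewrite /off; case: (e == f u).
    by apply: fork_continuous => z; exact: cvg_fst.
  case: (e == f v); last by move=> z; exact: cvg_cst.
  by apply: fork_continuous => z; exact: cvg_snd.
- by move=> z x e; rewrite /off; case: ifP => _; [|case: ifP => // _]; exact: fork_ge0.
- move=> z x; rewrite /off; case: eqP => [/(singleP _ _ su) ->|_]; first exact: fork_center.
  by case: eqP => [/(singleP _ _ sv) ->|//]; exact: fork_center.
- move=> z x y e xy; rewrite /off; case: ifP => _; first exact: fork_clique.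
  by case: ifP => _; [exact: fork_clique|rewrite mul0r].
- move=> z x y xy; rewrite /off; case: eqP => [/(singleP _ _ su) xu|_].
    by apply: fork_touch; rewrite -xu.
  by case: eqP => [/(singleP _ _ sv) xv|//]; apply: fork_touch; rewrite -xv.
- move=> [z1 z2] q qE; rewrite /phi !qE ?neqS ?neqP // /off eqxx uv eqxx.
  by rewrite !fork_sub.
- move=> p pA ppos x e ex; rewrite /off.
  case: eqP => [eu|eu]; first by rewrite eu (single_column pA ppos) // -eu.
  case: eqP => [ev|ev]; first by rewrite ev (single_column pA ppos) // -ev.
  have [y ye] : exists y, f y = e.
    move: mf; rewrite negb_exists => /forallP/(_ e); rewrite negb_forall => /existsP[y].
    by rewrite negbK => /eqP; exists y.
  have ns : ~~ single f y.
    apply/negP => sy; case E: (odd y); first by apply: ev; rewrite -ye (vv y).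
    by apply: eu; rewrite -ye (uu y).
  have [fS|fP] := not_single vf ns.
    by rewrite -ye; apply: (full_column pA ppos) => //; rewrite ye.
  rewrite -ye -fP; apply: (full_column pA ppos); rewrite ?ord_predK ?fP //.
  by rewrite ye.
Qed.

(** Each point lies in the region of a vertex f: choose for x a color f x with
    p x (f x) > 0. *)
Lemma coloring_manifold : closed_2manifold R space.
Proof.
split.
- exact: (realization_compact coloring_realizationP).
- exact: hausdorff_coord.
- exact: second_countable_coord.
move=> p.
have [q0 q1 qe] := (coloring_realizationP (\val p)).1 (set_mem (valP p)).
have pos x : exists a, 0 < (\val p x a : R).
  apply/not_existsP => h; have /eqP := q1 x; rewrite big1 ?(eq_sym 0) ?oner_eq0 // => a _.
  by apply/eqP; rewrite eq_le q0 andbT leNgt; apply/negP; exact: h.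
have [g gpos] := choice pos.
pose h : {ffun V -> W} := [ffun x => g x].
have hpos x : 0 < (\val p x (h x) : R) by rewrite ffunE.
have vh : valid h.
  apply/validP => x y hxy; apply: contraT => nt; have /eqP := qe x y (h x) nt.
  by rewrite mulf_eq0 (gt_eqF (hpos x)) hxy (gt_eqF (hpos y)).
have [mh|mh] := boolP (missing h); first exact: chart_missing hpos.
exact: chart_surjective hpos.
Qed.

End Charts.

(** * The surface *)

Lemma coloring_connected (R : realType) r : (2 <= r)%N ->
  connected [set: realization R (coloring_complex r)]%classic.
Proof.
move=> hr; apply: realization_connected => [eta tau|T h h_inv f g].
  exact: complex_downward.
rewrite !vertex_cell_valid; apply: (valid_connected hr) => {}f x a vf lf.
have [->|fxa] := eqVneq a (f x).
  by rewrite recolor_id.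
have ua := legal_addable vf lf fxa.
apply: (h_inv _ _ _ (addable_complex ua)) => y; rewrite mem_add /= !ffunE finset.inE.
  by case: (y == x); rewrite eqxx ?orbT.
by rewrite eqxx orbT.
Qed.

Lemma genus_formula m : (2 <= m)%N ->
  (sphere_number m m.+1)%:R = (m`!)%:R * ((m%:R ^+ 2 - m%:R - 2) / 2) + 1 :> rat.
Proof.
move=> m2; have := congr1 (fun k : nat => k%:R : rat) (sphere_number_formula m2).
rewrite !natrD !natrM expr2 => e; lra.
Qed.

Lemma coloring_surface (R : realType) r : (2 <= r)%N ->
  let K := coloring_complex r in
  let g := sphere_number r r.+1 in
  let n := ((2 + r ^ 2) * (r.+1)`!)%N in
  [/\ orientable_cubical_surface_of_genus R K g,
      g%:R = (r`!)%:R * ((r%:R ^+ 2 - r%:R - 2) / 2) + 1 :> rat,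
      #|cells K 0| = n,
      #|cells K 1| = (2 * (n + 2 * g - 2))%N &
      #|cells K 2| = (n + 2 * g - 2)%N].
Proof.
move=> hr K g n.
have V_n : #|cells K 0| = n by rewrite card_vertices card_valid.
have F_n : #|cells K 2| = (n + 2 * g - 2)%N.
  by have := euler_characteristic hr; rewrite (edges_squares hr) -/K V_n -/g; lia.
split => //.
- split.
  + split; first exact: coloring_manifold.
      by move=> eta; exact: dim_le2.
    by move=> eta; exact: complex_square.
  + exact: coloring_connected.
  + exact: coloring_orientable.
  + exact: coloring_betti1.
- exact: genus_formula.
- by rewrite (edges_squares hr) F_n.
Qed.

Theorem theorem20 (R : realType) (r : nat) (hr : (2 <= r)%N) :
  let K := HomComplex (complement (cycle_graph (2 * r))) (complete_graph r.+1) in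
  let g := sphere_number r r.+1 in
  let n := ((2 + r ^ 2) * (r.+1)`!)%N in
  [/\ orientable_cubical_surface_of_genus R K g,
      g%:R = (r`!)%:R * ((r%:R ^+ 2 - r%:R - 2) / 2) + 1 :> rat,
      #|cells K 0| = n,
      #|cells K 1| = (2 * (n + 2 * g - 2))%N &
      #|cells K 2| = (n + 2 * g - 2)%N].
Proof. by have := coloring_surface R hr; rewrite coloring_complex.unlock. Qed.
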